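(* Let $\alpha\in(0,1)$, $\kappa>0$, $T>0$, let $\Omega\subset\mathbb{R}^d$, $d\in\{1,2,3\}$, be a bounded smooth domain, and let $u_0\in H^2(\Omega)\cap H_0^1(\Omega)$ satisfy $|u_0(x)|\le1$ for $x\in\Omega$. Then the solution $u$ of the time-fractional Allen-Cahn equation $$\partial_t^\alpha u-\kappa^2\Delta u=u-u^3\ \text{ in }\Omega\times(0,T),\qquad u=0\ \text{ on }\partial\Omega\times(0,T),\qquad u(\cdot,0)=u_0\ \text{ in }\Omega,$$ satisfies the maximum principle $$|u(x,t)|\le1\qquad\text{for all }(x,t)\in\Omega\times(0,T].$$
   Context: The Caputo derivative of order $\alpha$ is $\partial_t^\alpha u(x,t)=\frac{1}{\Gamma(1-\alpha)}\int_0^t(t-s)^{-\alpha}\partial_s u(x,s)\,ds$. The solution is the unique solution $u\in C^\alpha([0,T];L^2(\Omega))\cap C([0,T];H^2(\Omega)\cap H_0^1(\Omega))$ with $\partial_t^\alpha u\in C([0,T];L^2(\Omega))$, extended to $t=T$ by continuity. *)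

(* Defs.v *)
From HB Require Import structures.
From mathcomp Require Import all_boot all_order all_algebra.
From mathcomp Require Import all_classical all_reals all_analysis.
Set Implicit Arguments.
Unset Strict Implicit.
Unset Printing Implicit Defensive.
Import Order.TTheory GRing.Theory Num.Theory.
Import numFieldNormedType.Exports.
Local Open Scope classical_set_scope.
Local Open Scope ring_scope.

(* R^d is 'rV[R]_d, with the library's topology and the product sigma-algebra,
   generated by the coordinates (hence the Borel one). *)
Section measurable_row.
Variables (R : realType) (d : nat).

Let coord (i : 'I_d) (x : 'rV[R]_d) : measurableTypeR R := x ord0 i.

Let row_set0 : g_sigma_preimage coord set0.
Proof. exact: sigma_algebra0. Qed.

Let row_setC A : g_sigma_preimage coord A -> g_sigma_preimage coord (~` A).
Proof. exact: sigma_algebraC. Qed.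

Let row_bigcup (F : (set 'rV[R]_d)^nat) :
  (forall i, g_sigma_preimage coord (F i)) ->
  g_sigma_preimage coord (\bigcup_i F i).
Proof. exact: sigma_algebra_bigcup. Qed.

HB.instance Definition _ := @isMeasurable.Build
  (measure_tuple_display default_measure_display) 'rV[R]_d
  (g_sigma_preimage coord) row_set0 row_setC row_bigcup.

Lemma measurable_coord (i : 'I_d) :
  measurable_fun [set: 'rV[R]_d] (fun x => x ord0 i : measurableTypeR R).
Proof.
move=> _ Y mY; rewrite setTI; apply: sub_sigma_algebra => /=.
rewrite -bigcup_seq/=; exists i => /=; first by rewrite mem_index_enum.
by exists Y => //; rewrite setTI.
Qed.

Lemma measurable_rowP d0 (T : measurableType d0) (f : T -> 'rV[R]_d) :
  (forall i, measurable_fun [set: T]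
     (fun t => f t ord0 i : measurableTypeR R)) ->
  measurable_fun [set: T] f.
Proof.
move=> mf.
have sub : g_sigma_preimage (fun i => coord i \o f) `<=` measurable.
  apply: smallest_sub; first exact: sigma_algebra_measurable.
  by rewrite -bigcup_seq; apply: bigcup_sub => i _ A [B mB <-]; exact: mf.
move=> _ A mA; apply: sub.
by rewrite g_sigma_preimage_comp; exists A.
Qed.

End measurable_row.

(* The d-dimensional Lebesgue measure: Dirac mass for d = 0, then the image of
   lebesgue_measure \x (n-dimensional one) under R * R^n -> R^(n+1). *)
Section lebesgue_row.
Variable R : realType.

Definition row_cons n (p : measurableTypeR R * 'rV[R]_n) : 'rV[R]_n.+1 :=
  \row_i oapp (fun j => p.2 ord0 j) p.1 (unlift ord0 i).

Definition row_uncons n (x : 'rV[R]_n.+1) : measurableTypeR R * 'rV[R]_n :=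
  (x ord0 ord0, \row_j x ord0 (lift ord0 j)).

Lemma row_consK n : cancel (@row_cons n) (@row_uncons n).
Proof.
move=> [a x]; rewrite /row_uncons /row_cons mxE unlift_none /=; congr pair.
by apply/rowP => j; rewrite !mxE liftK.
Qed.

Lemma measurable_row_cons n : measurable_fun [set: _] (@row_cons n).
Proof.
apply: measurable_rowP => i; under eq_fun do rewrite mxE.
case: (unlift ord0 i) => [j|] /=; last exact: measurable_fst.
exact: measurableT_comp (measurable_coord j) measurable_snd.
Qed.

Lemma measurable_row_uncons n : measurable_fun [set: _] (@row_uncons n).
Proof.
apply/measurable_fun_pairP; split; first exact: measurable_coord.
apply: measurable_rowP => i.
have -> : (fun t : 'rV[R]_n.+1 => ((snd \o @row_uncons n) t) ord0 i) =
          (fun t => t ord0 (lift ord0 i)).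
  by apply/funext => t; rewrite /= mxE.
exact: measurable_coord.
Qed.

Definition lebesgue_cons n (mu : {sigma_finite_measure set 'rV[R]_n -> \bar R})
    : set 'rV[R]_n.+1 -> \bar R :=
  pushforward (lebesgue_measure \x mu)%E (@row_cons n).

Section lebesgue_cons.
Variables (n : nat) (mu : {sigma_finite_measure set 'rV[R]_n -> \bar R}).

HB.instance Definition _ := Measure.copy (lebesgue_cons mu)
  (measure_function_pushforward__canonical__measure_function_Measure
     (lebesgue_measure \x mu)%E (@measurable_row_cons n)).

Let sigma_finite_lebesgue_cons : sigma_finite setT (lebesgue_cons mu).
Proof.
have /sigma_finiteP[F [TF ndF Foo]] := sigma_finiteT (@lebesgue_measure R).
have /sigma_finiteP[G [TG ndG Goo]] := sigma_finiteT mu.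
exists (fun k => @row_uncons n @^-1` (F k `*` G k)).
  rewrite -preimage_bigcup (_ : \bigcup_k _ = setT) ?preimage_setT//.
  apply/seteqP; split => // -[a x] _.
  have [k _ Fka] : (\bigcup_k F k) a by rewrite -TF.
  have [l _ Glx] : (\bigcup_k G k) x by rewrite -TG.
  exists (maxn k l) => //; split => /=.
  - by move: a Fka; exact/subsetPset/ndF/leq_maxl.
  - by move: x Glx; exact/subsetPset/ndG/leq_maxr.
move=> k; have [mF ?] := Foo k; have [mG ?] := Goo k; split.
  rewrite -[X in measurable X]setTI.
  by apply: measurable_row_uncons => //; exact: measurableX.
suff E : @row_cons n @^-1` (@row_uncons n @^-1` (F k `*` G k)) = F k `*` G k.
  rewrite /lebesgue_cons /pushforward E product_measure1E//.
  by rewrite lte_mul_pinfty// ge0_fin_numE.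
by rewrite -comp_preimage (_ : _ \o _ = id) ?preimage_id//; apply/funext/row_consK.
Qed.

HB.instance Definition _ := @Measure_isSigmaFinite.Build _ _ _
  (lebesgue_cons mu) sigma_finite_lebesgue_cons.

End lebesgue_cons.

Fixpoint lebesgue_row (d : nat) : {sigma_finite_measure set 'rV[R]_d -> \bar R} :=
  if d is n.+1 then lebesgue_cons (lebesgue_row n) else \d_(0 : 'rV[R]_0).

End lebesgue_row.
Arguments lebesgue_row {R} d.

Section sobolev.
Variables (R : realType) (d : nat).
Local Notation E := 'rV[R]_d.
Local Notation mu := (lebesgue_row d).
Implicit Types (Omega : set E) (f g phi gamma : E -> R) (i j : 'I_d).

Definition partial i f : E -> R := fun x => 'D_(delta_mx ord0 i) f x.

Definition partials (s : seq 'I_d) f : E -> R := foldr partial f s.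

Definition smooth f := forall s x,
  {for x, continuous (partials s f)} /\
  forall i, derivable (partials s f) x (delta_mx ord0 i).

(* C_c^oo(Omega) *)
Definition test_function Omega phi :=
  let supp := closure [set x | phi x != 0] in
  [/\ smooth phi, compact supp & supp `<=` Omega].

(* Up to the choice of the coordinate i and of a sign, Omega is locally the
   epigraph of a C^oo function gamma of the remaining coordinates: the i-th
   coordinate is set to 0 before gamma is applied. *)
Definition smooth_boundary Omega :=
  forall p, closure Omega p -> ~ interior Omega p ->
  exists i (b : bool) gamma (r : R), [/\ smooth gamma, 0 < r &
    forall x, ball p r x ->
      (Omega x <-> gamma (x - x ord0 i *: delta_mx ord0 i)
                     < (-1) ^+ b * x ord0 i)].

Definition bounded_smooth_domain Omega :=
  [/\ Omega !=set0, open Omega, connected Omega, bounded_set Omega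
    & smooth_boundary Omega].

Definition L2 Omega f := (f \_ Omega) \in Lfun mu 2%:E.

Definition L2norm Omega f : \bar R := ('N[mu]_2%:E [EFin \o (f \_ Omega)])%E.

Definition weak_partials Omega i f : set (E -> R) :=
  [set g | L2 Omega g /\ forall phi, test_function Omega phi ->
    (\int[mu]_(x in Omega) (f x * partial i phi x) =
     - \int[mu]_(x in Omega) (g x * phi x))%R].

(* A representative of the weak derivative when it exists in L^2(Omega); it is
   then unique almost everywhere. *)
Definition weak_partial Omega i f : E -> R :=
  xget (cst 0) (weak_partials Omega i f).

Definition H1 Omega f :=
  L2 Omega f /\ forall i, weak_partials Omega i f !=set0.

Definition H1norm Omega f : \bar R :=
  (L2norm Omega f + \sum_(i < d) L2norm Omega (weak_partial Omega i f))%E.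

Definition H2 Omega f :=
  H1 Omega f /\ forall i, H1 Omega (weak_partial Omega i f).

Definition H2norm Omega f : \bar R :=
  (L2norm Omega f + \sum_(i < d) H1norm Omega (weak_partial Omega i f))%E.

(* The closure of C_c^oo(Omega) in H^1(Omega). *)
Definition H10 Omega f :=
  H1 Omega f /\ forall e : R, 0 < e ->
    exists2 phi, test_function Omega phi & (H1norm Omega (f \- phi)%R < e%:E)%E.

Definition weak_laplacian Omega f : E -> R :=
  fun x => \sum_(i < d) weak_partial Omega i (weak_partial Omega i f) x.

End sobolev.

(* A function R^d x [0,T] -> R is curried as u t x; for each t, u t is an
   arbitrary representative of its class modulo equality a.e. on Omega. *)
Section allen_cahn.
Variables (R : realType) (d : nat).
Local Notation E := 'rV[R]_d.
Local Notation leb := (@lebesgue_measure R).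
Local Notation mu := (lebesgue_row d).
Implicit Types (Omega : set E) (T alpha kappa t : R) (u v w : R -> E -> R).

Definition continuous_in_norm (N : (E -> R) -> \bar R) T u :=
  forall t, t \in `[0, T] ->
    N (u s \- u t) @[s --> within `[0, T] (nbhs t)] --> 0%E.

(* C([0,T]; L^2(Omega)) *)
Definition C_L2 Omega T u :=
  (forall t, t \in `[0, T] -> L2 Omega (u t)) /\
  continuous_in_norm (L2norm Omega) T u.

(* C([0,T]; H^2(Omega) \cap H^1_0(Omega)) *)
Definition C_H2_H10 Omega T u :=
  (forall t, t \in `[0, T] -> H2 Omega (u t) /\ H10 Omega (u t)) /\
  continuous_in_norm (H2norm Omega) T u.

(* C^alpha([0,T]; L^2(Omega)) *)
Definition Holder_L2 Omega T alpha u :=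
  (forall t, t \in `[0, T] -> L2 Omega (u t)) /\
  exists C : R, forall s t, s \in `[0, T] -> t \in `[0, T] ->
    (L2norm Omega (u s \- u t)%R <= (C * `|s - t| `^ alpha)%:E)%E.

(* v = \partial_t u in L^1(0,T; L^2(Omega)): u is the indefinite Bochner
   integral of v. *)
Definition time_derivative Omega T u v :=
  [/\ measurable_fun (`[0, T] `*` Omega : set (measurableTypeR R * E))
        (fun p => v p.1 p.2),
      (\int[leb]_(t in `[0%R, T]) L2norm Omega (v t) < +oo)%E
    & forall t, t \in `[0, T] -> {ae mu, forall x, Omega x ->
        u t x = u 0 x + (\int[leb]_(s in `[0%R, t]) v s x)%R}].

Definition Gamma (z : R) : R :=
  (\int[leb]_(t in `]0%R, +oo[) (t `^ (z - 1) * expR (- t)))%R.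

Definition caputo_formula alpha v t (x : E) : R :=
  (Gamma (1 - alpha))^-1 *
  (\int[leb]_(s in `[0%R, t]) ((t - s) `^ (- alpha) * v s x))%R.

(* w is the Caputo derivative of u, as a class of functions of time with values
   in L^2(Omega): the defining integral need only converge for almost every t,
   and at t = 0, where it is over a null set, a continuous w need not vanish. *)
Definition caputo_derivative Omega T alpha u w :=
  exists2 v, time_derivative Omega T u v &
    {ae leb, forall t, t \in `]0, T[ -> {ae mu, forall x, Omega x ->
       w t x = caputo_formula alpha v t x}}.

(* The boundary condition is u(t) \in H^1_0(Omega). *)
Definition allen_cahn_solution Omega T alpha kappa (u0 : E -> R) u :=
  [/\ Holder_L2 Omega T alpha u,
      C_H2_H10 Omega T u,
      exists w, [/\ caputo_derivative Omega T alpha u w, C_L2 Omega T w &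
        forall t, t \in `]0, T[ -> {ae mu, forall x, Omega x ->
          w t x - kappa ^+ 2 * weak_laplacian Omega (u t) x
          = u t x - u t x ^+ 3}]
    & {ae mu, forall x, Omega x -> u 0 x = u0 x}].

End allen_cahn.

(* Main.v *)
(* The equation is tested with [excess u], where [excess] is a bounded smooth nondecreasing odd
   function vanishing exactly on [-1,1].
   The right-hand side is favourable: [(u - u^3) excess u <= 0], strictly where [|u| > 1], and
   [\int Delta u excess u <= 0], because an [H^1_0] function is a limit of test functions [phi],
   for which [excess \o phi] is again a test function; this is where smoothness of [excess] is
   needed.  So the energy [J(t) = \int_Omega D^alpha u(t) excess(u(t))] is [<= 0] for a.e. [t].
   Conversely the integral of [J] over [0,T] is [>= 0]: the kernel [r^-alpha] is a positive
   superposition of indicators of intervals [0 < r < rho], and for each of them and each [x], with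
   [u] extended by [u0] to negative times and [G] the convex primitive of [excess],
     [\int_0^T (u(t) - u(t - rho)) excess(u(t)) dt >= \int_0^T (G(u(t)) - G(u(t - rho))) dt >= 0]
   since [G(u0) = 0].  Hence [J = 0] and [|u(t)| <= 1] for a.e. [t]; the set of functions bounded
   by 1 is closed in [L^2], so continuity in time gives the bound for all [t]. *)
Require Import Defs.
From HB Require Import structures.
From mathcomp Require Import all_boot all_order all_algebra.
From mathcomp Require Import all_classical all_reals all_analysis.
From mathcomp Require Import measurable_realfun ring lra.
Set Implicit Arguments.
Unset Strict Implicit.
Unset Printing Implicit Defensive.
Import Order.TTheory GRing.Theory Num.Def Num.Theory.
Import numFieldNormedType.Exports.
Local Open Scope classical_set_scope.
Local Open Scope ring_scope.

(** * Lebesgue measure on row vectors *)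

(** Boundedness of [excess] makes [excess \o f] square integrable for every measurable [f] on a
    domain of finite measure. Integrability of the reaction term is read off the equation, which
    expresses it through [w] and the Laplacian, so no estimate of [u^3] is made. Smoothness, bounds
    and the convex primitive all come from the functions [P(1/z) e^(-1/z)] with [P] a polynomial.
    The main obstacle is that [u t] is a representative chosen separately at each time: no joint
    measurability of [u] is given, the Caputo formula holds only almost everywhere, and the velocity
    is merely integrable in time. A pointwise inequality for the fractional derivative of [G(u)]
    would ask for more regularity in time. The energy is therefore integrated over time, where
    Fubini suffices, and is evaluated on a jointly measurable substitute, the primitive of the
    velocity, which agrees with [u t] almost everywhere for each [t] in ]0, T[. Slicing the kernel
    by levels replaces an integration by parts against a singular kernel: over an interval the
    velocity integrates to an increment. *)

Section row_measure.
Variable R : realType.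
Local Notation leb := (@lebesgue_measure R).

Lemma measurable_row_box d (A : 'I_d -> set R) :
  (forall i, measurable (A i)) ->
  measurable [set x : 'rV[R]_d | forall i, A i (x ord0 i)].
Proof.
move=> mA.
have -> : [set x : 'rV[R]_d | forall i, A i (x ord0 i)] =
    \bigcap_(i in [set: 'I_d]) ((fun x : 'rV[R]_d => x ord0 i) @^-1` A i).
  by apply/seteqP; split => x /= h i; [move=> _; exact: h|exact: h].
apply: fin_bigcap_measurable. exact: finite_finset.
by move=> i _; rewrite -[X in measurable X]setTI; have := @measurable_coord R d i measurableT (A i) (mA i).
Qed.

Lemma lebesgue_row_box d (A : 'I_d -> set R) :
  (forall i, measurable (A i)) ->
  lebesgue_row d [set x : 'rV[R]_d | forall i, A i (x ord0 i)] =
  (\prod_i leb (A i))%E.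
Proof.
elim: d A => [|n IH] A mA.
  by rewrite big_ord0 /= diracE mem_set// => -[].
rewrite big_ord_recl -IH//.
pose B := [set x : 'rV[R]_n | forall i, A (lift ord0 i) (x ord0 i)].
have mB : measurable B.
  exact: (measurable_row_box (A := fun i => A (lift ord0 i))).
transitivity ((leb \x lebesgue_row n)%E (A ord0 `*` B)); last first.
  exact: (@product_measure1E _ _ (measurableTypeR R) _ R leb (lebesgue_row n) (A ord0) B (mA ord0) mB).
rewrite /= /lebesgue_cons /pushforward; congr (_ _).
apply/seteqP; split => -[a x] /=.
  move=> h; split; first by have := h ord0; rewrite mxE unlift_none.
  by move=> i; have := h (lift ord0 i); rewrite mxE liftK.
move=> [h0 h1] i; rewrite mxE; case: unliftP => [j ->|->] //=.
Qed.

Lemma row_ballE d (x y : 'rV[R]_d) r : 0 < r ->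
  ball x r y <-> forall i, ball (x ord0 i) r (y ord0 i).
Proof.
move=> r0; split=> [[_ h] i|h]; first exact: h.
by split=> // i j; rewrite ord1.
Qed.

Lemma measurable_row_ball d (x : 'rV[R]_d) r : 0 < r -> measurable (ball x r).
Proof.
move=> r0.
have -> : ball x r = [set y | forall i, ball (x ord0 i) r (y ord0 i)].
  by apply/seteqP; split=> y /row_ballE; apply.
by apply: (measurable_row_box (A := fun i => ball (x ord0 i) r)) => i; rewrite ball_itv; exact: measurable_itv.
Qed.

(** The sigma-algebra is generated by the coordinates, so an open set has to be written as a
    countable union of boxes: the sup-norm balls inside it with rational centre and radius
    [1/(n+1)]. *)
Lemma open_measurable_row d (A : set 'rV[R]_d) : open A -> measurable A.
Proof.
move=> oA.
pose F (p : 'rV[rat]_d * nat) : set 'rV[R]_d :=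
  if pselect (ball (map_mx ratr p.1 : 'rV[R]_d) (p.2.+1%:R^-1 : R) `<=` A)
  then ball (map_mx ratr p.1 : 'rV[R]_d) (p.2.+1%:R^-1) else set0.
have -> : A = \bigcup_p F p.
  apply/seteqP; split => [x Ax|x [p _]]; last first.
    by rewrite /F; case: pselect => // h /h.
  have /nbhs_ballP[e /= e0 xeA] : nbhs x A by exact: oA.
  have [n ne] : exists n, n.+1%:R^-1 < e / 2.
    have := divr_gt0 e0 (ltr0Sn R 1).
    move=> e20; have [n _ /(_ n) h] := near_infty_natSinv_lt (PosNum e20).
    by exists n; apply: h => /=.
  have n0 : 0 < (n.+1%:R^-1 : R) by rewrite invr_gt0.
  have /choice[q qE] : forall i, exists q : rat, `|ratr q - x ord0 i| < (n.+1%:R^-1 : R).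
    move=> i.
    have /rat_in_itvoo[q] : x ord0 i - n.+1%:R^-1 < x ord0 i + n.+1%:R^-1.
      by rewrite ltrD2l gtrN.
    by rewrite in_itv /= => qi; exists q; rewrite ltr_distl.
  exists (\row_i q i, n) => //.
  have xq : ball (map_mx ratr (\row_i q i) : 'rV[R]_d) n.+1%:R^-1 x.
    by apply/row_ballE => // i; rewrite !mxE /ball /=.
  rewrite /F /=; case: pselect => // -[] y yq; apply: xeA.
  have : ball x (n.+1%:R^-1 + n.+1%:R^-1) y.
    by apply: ball_triangle yq; exact: ball_sym.
  by apply: le_ball; rewrite [leRHS]splitr lerD// ltW.
apply: countable_bigcupT_measurable => // p.
rewrite /F; case: pselect => h /=; last exact: measurable0.
by apply: measurable_row_ball; rewrite invr_gt0.
Qed.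

Lemma continuous_measurable_row d (f : 'rV[R]_d -> R) :
  continuous f -> measurable_fun [set: 'rV[R]_d] (f : _ -> measurableTypeR R).
Proof.
move=> /continuousP cf; apply: (measurability _ (RGenOpens.measurableE R)).
move=> _ [_ [a [b ->] <-]]; rewrite setTI.
by apply: open_measurable_row; exact/cf/interval_open.
Qed.

Lemma row_normE d (x : 'rV[R]_d) i : `|x ord0 i| <= `|x|.
Proof.
rewrite [leRHS]/Num.norm /= mx_normrE; apply/bigmax_geP; right => /=.
by exists (ord0, i).
Qed.

Lemma lebesgue_row_box_lty d (M : R) :
  (lebesgue_row d [set x : 'rV[R]_d | forall i, `|x ord0 i| <= M]%R < +oo)%E.
Proof.
have -> : [set x : 'rV[R]_d | forall i, `|x ord0 i| <= M] =
    [set x | forall i, `[- M, M]%classic (x ord0 i)].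
  by apply/seteqP; split => x /= h i; have := h i; rewrite in_itv /= ler_norml.
rewrite (lebesgue_row_box (A := fun=> `[- M, M]%classic))//=.
suff /andP[] : (0 <= \prod_(i < d) leb `[(- M)%R, M]%classic < +oo)%E by [].
elim/big_ind : _ => [|x y|i _].
- by rewrite lee_fin ler01 ltry.
- move=> /andP[x0 xoo] /andP[y0 yoo].
  by rewrite mule_ge0//= lte_mul_pinfty// ge0_fin_numE.
- rewrite measure_ge0 lebesgue_measure_itv /=; by case: ifPn; rewrite -?EFinB ltry.
Qed.

Lemma bounded_set_lebesgue_row_lty d (A : set 'rV[R]_d) :
  measurable A -> bounded_set A -> (lebesgue_row d A < +oo)%E.
Proof.
move=> mA [M [_ AM]].
apply: le_lt_trans (lebesgue_row_box_lty d (M + 1)).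
apply: le_measure; rewrite ?inE//.
  by apply: (measurable_row_box (A := fun=> [set x | `|x| <= M + 1])) => i;
    rewrite (_ : [set _ | _] = `[- (M + 1), M + 1]%classic);
    [exact: measurable_itv | apply/seteqP; split => x /=; rewrite in_itv /= ler_norml].
by move=> x Ax i; apply: le_trans (row_normE x i) _; apply: AM => //; rewrite ltrDl.
Qed.

(** An open set contains a cube of positive side. This is what later turns an almost everywhere
    bound into a bound at continuity points. *)
Lemma lebesgue_row_open_gt0 d (A : set 'rV[R]_d) :
  open A -> A !=set0 -> (0 < lebesgue_row d A)%E.
Proof.
move=> oA [x Ax].
have /nbhs_ballP[e /= e0 xeA] : nbhs x A by exact: oA.
apply: (@lt_le_trans _ _ (lebesgue_row d (ball x e))); last first.
  by apply: le_measure; rewrite ?inE//; [exact: measurable_row_ball|exact: open_measurable_row].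
have -> : ball x e = [set y | forall i, ball (x ord0 i) e (y ord0 i)].
  by apply/seteqP; split=> y /row_ballE; apply.
rewrite (lebesgue_row_box (A := fun i => ball (x ord0 i) e)); last first.
  by move=> i; rewrite ball_itv; exact: measurable_itv.
elim/big_ind : _ => //; first by move=> a b a0 b0; rewrite mule_gt0.
by move=> i _; rewrite lebesgue_measure_ball ?ltW// lte_fin mulrn_wgt0.
Qed.

End row_measure.

(** * Integrals of partial derivatives of compactly supported functions *)

Section integral_partial.
Variable R : realType.
Local Notation leb := (@lebesgue_measure R).

Lemma derive_eq0_off (V W : normedModType R) (f : V -> W) (M : R) v x :
  (forall y, f y != 0 -> `|y| <= M) -> M < `|x| -> 'D_v f x = 0.
Proof.
move=> fM Mx; rewrite -(@derive_cst _ V W 0 x v); apply: near_eq_derive.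
have : \forall y \near x, M < `|y|.
  by apply: (cvgr_gt `|x|) => //; exact: norm_continuous.
apply: filterS => y My; apply/eqP/negPn/negP => /fM.
by rewrite leNgt My.
Qed.

Lemma integral_derive1_eq0 (f : R -> R) M :
  (forall x, derivable f x 1) -> continuous (derive1 f) ->
  (forall x, f x != 0 -> `|x| <= M) ->
  (\int[leb]_x ((derive1 f) x)%:E = 0)%E.
Proof.
(* [N] exceeds [M], so [f] vanishes at both ends of [-N, N], and it is positive, so that interval is
   nondegenerate. *)
move=> df cf fM; pose N : R := `|M| + 1.
have MN : M < N by rewrite ltr_pwDr// ler_norm.
have N0 : 0 < N by rewrite ltr_pwDr.
have fN x : N <= `|x| -> f x = 0.
  move=> Nx; apply/eqP/negPn/negP => /fM; rewrite leNgt => /negP; apply.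
  exact: lt_le_trans MN Nx.
transitivity (\int[leb]_(x in `[(- N)%R, N]) ((derive1 f) x)%:E)%E.
  rewrite [RHS]integral_mkcond; apply: eq_integral => x _; rewrite patchE.
  case: ifPn => //; rewrite notin_setE /= in_itv /= -ler_norml => /negP.
  rewrite -ltNge => Nx; rewrite derive1E (derive_eq0_off (M := M))//.
  exact: lt_trans MN Nx.
have cf' : continuous f by move=> x; apply: differentiable_continuous; exact/derivable1_diffP.
rewrite (continuous_FTC2 (F := f))//.
- by rewrite !fN ?subee// ?normrN ger0_norm// ltW.
- by rewrite gtrN.
- exact: continuous_subspaceT.
- split=> [x _||]; first exact: df.
  + exact/cvg_at_right_filter/cf'.
  + exact/cvg_at_left_filter/cf'.
Qed.

Lemma compact_support_bounded d (h : 'rV[R]_d -> R) M :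
  continuous h -> (forall x, h x != 0 -> `|x| <= M) ->
  exists2 C, 0 <= C & forall x, `|h x| <= C.
Proof.
move=> ch hM.
have cB : compact [set x : 'rV[R]_d | `|x| <= M].
  apply: bounded_closed_compact.
    by exists M; split; [exact: num_real|move=> r Mr x /= xM; exact: le_trans xM (ltW Mr)].
  rewrite (_ : [set _ | _] = normr @^-1` [set x : R | x <= M])//.
  apply: closed_comp; last exact: closed_le.
  by move=> x _; exact: norm_continuous.
have /compact_bounded[C [_ hC]] := continuous_compact (continuous_subspaceT ch) cB.
exists (`|C| + 1); first by rewrite addr_ge0.
move=> x; have [->|hx0] := eqVneq (h x) 0; first by rewrite normr0 addr_ge0.
by apply: hC; [rewrite ltr_pwDr// ler_norm|exists x => //=; exact: hM].
Qed.

Lemma compact_support_integrable d (h : 'rV[R]_d -> R) M :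
  continuous h -> (forall x, h x != 0 -> `|x| <= M) ->
  (lebesgue_row d).-integrable setT (EFin \o h).
Proof.
move=> ch hM; have [C C0 hC] := compact_support_bounded ch hM.
pose B : set 'rV[R]_d := [set x | `|x| <= M].
have mB : measurable B.
  have -> : B = ~` (normr @^-1` [set x : R | M < x]).
    by apply/seteqP; split => x /=; rewrite /B /= leNgt => /negP.
  apply: measurableC; apply: open_measurable_row.
  apply: (@open_comp _ _ (normr : 'rV[R]_d -> R)); last exact: (@open_gt R M).
  by move=> x _; exact: norm_continuous.
have mh := continuous_measurable_row ch.
have <- : (EFin \o h) \_ B = EFin \o h.
  apply/funext => x; rewrite patchE; case: ifPn => //.
  rewrite notin_setE /= => xB; congr EFin; apply/esym/eqP/negPn/negP => /hM.
  exact: xB.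
apply/(integrable_mkcond _ mB); apply: measurable_bounded_integrable => //.
- apply: bounded_set_lebesgue_row_lty => //.
  by exists M; split; [exact: num_real|move=> r Mr x /= xM; exact: le_trans xM (ltW Mr)].
- exact: measurable_funTS.
- exists C; split; first exact: num_real.
  by move=> y Cy x _; exact: le_trans (hC x) (ltW Cy).
Qed.

Lemma row_norm_le d (x : 'rV[R]_d) M : 0 <= M ->
  (forall i, `|x ord0 i| <= M) -> `|x| <= M.
Proof.
move=> M0 xM; rewrite [leLHS]/Num.norm /= mx_normrE.
by apply/bigmax_leP; split => // -[i j] _ /=; rewrite ord1.
Qed.

Lemma row_cons_continuousr n (a : R) : continuous (fun x : 'rV[R]_n => row_cons (a, x)).
Proof.
move=> x A /nbhs_ballP[e /= e0 eA].
apply/nbhs_ballP; exists e => //= y /(row_ballE _ _ e0) h; apply: eA.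
apply/row_ballE => // i; rewrite /row_cons !mxE.
by case: unlift => [j|] /=; [exact: h|exact: ballxx].
Qed.

Lemma row_cons_continuousl n (x : 'rV[R]_n) : continuous (fun a : R => row_cons (a, x)).
Proof.
move=> a A /nbhs_ballP[e /= e0 eA].
apply/nbhs_ballP; exists e => //= y h; apply: eA.
apply/row_ballE => // i; rewrite /row_cons !mxE.
by case: unlift => [j|] /=; [exact: ballxx|exact: h].
Qed.

Lemma row_consD0 n (a t : R) (x : 'rV[R]_n) :
  t *: delta_mx ord0 ord0 + row_cons (a, x) = row_cons (t + a, x).
Proof.
apply/rowP => i; rewrite !mxE /=; case: unliftP => [j ->|->] /=.
  by rewrite mulr0 add0r.
by rewrite mulr1.
Qed.

Lemma row_consD n (a t : R) (x : 'rV[R]_n) j :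
  t *: delta_mx ord0 (lift ord0 j) + row_cons (a, x) =
  row_cons (a, t *: delta_mx ord0 j + x).
Proof.
apply/rowP => i; rewrite !mxE /=; case: unliftP => [k ->|->] /=.
  by rewrite !mxE (inj_eq (@lift_inj _ _)).
by rewrite mulr0 add0r.
Qed.

(** Only derivatives in direction [i] are mentioned, so the hypotheses pass to slices. By Fubini the
    first coordinate is split off: if it is direction [i], the inner integral is the one-dimensional
    case; otherwise it is frozen and the induction hypothesis applies to the remaining
    coordinates. *)
Lemma integral_partial_eq0 d (f : 'rV[R]_d -> R) i M :
  continuous f -> (forall x, derivable f x (delta_mx ord0 i)) ->
  continuous (partial i f) -> (forall x, f x != 0 -> `|x| <= M) ->
  (\int[lebesgue_row d]_x (partial i f x)%:E = 0)%E.
Proof.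
elim: d f i => [|n IH] f i cf df cpf fM; first by case: i df cpf => [[]].
pose h := partial i f.
have hM x : h x != 0 -> `|x| <= M.
  by apply: contraR; rewrite -ltNge => /(derive_eq0_off (delta_mx ord0 i) fM) /eqP.
have mh : measurable_fun setT (EFin \o h).
  by apply/measurable_EFinP; exact: continuous_measurable_row.
have mh2 : measurable_fun setT ((EFin \o h) \o @row_cons R n).
  by apply: measurableT_comp => //; exact: measurable_row_cons.
have ih2 : (leb \x lebesgue_row n)%E.-integrable setT ((EFin \o h) \o @row_cons R n).
  have /integrableP[_ ih] := compact_support_integrable cpf hM.
  apply/integrableP; split => //.
  apply: le_lt_trans ih; rewrite /= /lebesgue_cons.
  rewrite (ge0_integral_pushforward (@measurable_row_cons R n)) ?lexx//.
  exact: (measurableT_comp (@abse_measurable R setT) mh).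
transitivity (\int[(leb \x lebesgue_row n)%E]_x ((EFin \o h) \o @row_cons R n) x)%E.
  exact: (@integral_pushforward _ _ _ _ _ _ (@measurable_row_cons R n) _ setT _ mh ih2 measurableT).
case: (unliftP ord0 i) => [j ij|i0].
- rewrite -(integral12_prod_meas1 ih2).
  apply: integral0_eq => a _; rewrite /fubini_F /=.
  pose fa := fun y => f (row_cons (a, y)).
  have hE y : h (row_cons (a, y)) = partial j fa y.
    rewrite /h ij /partial /derive.
    by under eq_fun do rewrite /= row_consD.
  under eq_integral do rewrite hE.
  apply: IH.
  + by move=> x; exact: (@continuous_comp _ _ _ (fun y => row_cons (a, y)) f x (@row_cons_continuousr _ a x) (cf _)).
  + move=> x; have := df (row_cons (a, x)); rewrite ij /derivable.
    by under eq_fun do rewrite /= row_consD.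
  + move=> x; rewrite -(funext hE).
    by exact: (@continuous_comp _ _ _ (fun y => row_cons (a, y)) h x (@row_cons_continuousr _ a x) (cpf _)).
  + move=> x /fM rM; apply: row_norm_le => [|k].
      exact: le_trans (normr_ge0 _) rM.
    by have := le_trans (row_normE (row_cons (a, x)) (lift ord0 k)) rM; rewrite mxE liftK.
- rewrite -(integral21_prod_meas1 ih2).
  apply: integral0_eq => x _; rewrite /fubini_G /=.
  pose fx := fun b => f (row_cons (b, x)).
  have hE b : h (row_cons (b, x)) = derive1 fx b.
    rewrite /h i0 /partial /derive /derive1.
    by under eq_fun do rewrite /= row_consD0.
  under eq_integral do rewrite hE.
  apply: (@integral_derive1_eq0 fx M).
  + move=> b; have := df (row_cons (b, x)); rewrite i0 /derivable.
    under eq_fun do rewrite /= row_consD0.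
    by under [in X in _ -> X]eq_fun do rewrite /= [_%:A]mulr1.
  + move=> b; rewrite -(funext hE).
    by exact: (@continuous_comp _ _ _ (fun b => row_cons (b, x)) h b (@row_cons_continuousl _ x b) (cpf _)).
  + move=> b /fM; apply: le_trans.
    by have := row_normE (row_cons (b, x)) ord0; rewrite mxE unlift_none.
Qed.

End integral_partial.

(** * The excess function *)

Section bump_profile.
Variable R : realType.
Implicit Types (P : {poly R}) (x y z : R).

(** The flat function [P(1/z) e^(-1/z)], extended by 0. The whole family in [P] is introduced
    because it is closed under differentiation: one computation of a first derivative then gives
    smoothness. *)
Definition profile P z : R := if 0 < z then P.[z^-1] * expR (- z^-1) else 0.

(* With [y = 1/z], [d/dz (P(y) e^-y) = y^2 (P - P')(y) e^-y]. *)
Definition profile_deriv P : {poly R} := 'X^2 * (P - P^`()).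

(** Horner induction: half of the exponent goes to the induction hypothesis, and the other half
    absorbs the new factor through [y <= (2/e) e^(e y/2)]. This is why [e] is arbitrary. *)
Lemma poly_expR_bound P (e : R) : 0 < e ->
  exists2 C : R, 0 <= C & forall y, 0 <= y -> `|P.[y]| <= C * expR (e * y).
Proof.
elim/poly_ind: P e => [|p c IH] e e0.
  by exists 0 => // y _; rewrite horner0 normr0 mul0r.
have [C C0 hC] := IH (e / 2) (divr_gt0 e0 (ltr0Sn _ _)).
exists (C * (2 / e) + `|c|); first by rewrite addr_ge0// mulr_ge0// divr_ge0// ltW.
move=> y y0; rewrite hornerMXaddC (le_trans (ler_normD _ _))// mulrDl lerD//; last first.
  by rewrite ler_peMr// -expR0 ler_expR mulr_ge0// ltW.
rewrite normrM (ger0_norm y0) mulrAC.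
have -> : expR (e * y) = expR (e / 2 * y) * expR (e / 2 * y).
  by rewrite -expRD -mulrDl -splitr.
have ye : y <= 2 / e * expR (e / 2 * y).
  rewrite mulrC -ler_pdivrMr ?divr_gt0// invf_div mulrC.
  apply: le_trans (expR_ge1Dx _); lra.
rewrite mulrA [leRHS](_ : _ = (C * expR (e / 2 * y)) * (2 / e * expR (e / 2 * y))); last by ring.
by apply: ler_pM => //; exact: hC.
Qed.

Lemma profile_bound P : exists2 C : R, 0 <= C & forall z, `|profile P z| <= C.
Proof.
have [C C0 hC] := poly_expR_bound P ltr01.
exists C => // z; rewrite /profile; case: ifPn => z0; last by rewrite normr0.
rewrite normrM (ger0_norm (expR_ge0 _)) expRN ler_pdivrMr ?expR_gt0//.
by rewrite -[X in expR X]mul1r hC// invr_ge0 ltW.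
Qed.

(** Extracting a factor [z] at the price of a higher polynomial gives both the continuity and the
    difference quotient at 0. *)
Lemma profileMX P z : profile P z = z * profile ('X * P) z.
Proof.
rewrite /profile; case: ifPn => z0; last by rewrite mulr0.
by rewrite hornerM hornerX -mulrA mulVKf// gt_eqF.
Qed.

Lemma profile_cvg0 P : {for 0, continuous (profile P)}.
Proof.
have [C C0 hC] := profile_bound ('X * P).
have p0 : profile P 0 = 0 by rewrite /profile ltxx.
rewrite /prop_for /continuous_at p0.
have cC : C * `|z| @[z --> (0 : R)] --> C * `|0 : R|.
  by apply: cvgM; [exact: cvg_cst|exact: norm_continuous].
rewrite normr0 mulr0 in cC.
have cN : - (C * `|z|) @[z --> (0 : R)] --> - (0 : R) by exact: cvgN.
rewrite oppr0 in cN.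
apply: (squeeze_cvgr _ cN cC); near=> z.
by rewrite -ler_norml profileMX normrM mulrC ler_wpM2r.
Unshelve. all: by end_near. Qed.

Lemma is_derive_profile P z :
  is_derive z 1 (profile P) (profile (profile_deriv P) z).
Proof.
have [z0|z0|->] := ltgtP z 0.
- have -> : profile (profile_deriv P) z = 0 by rewrite /profile ltNge (ltW z0).
  apply: (@near_eq_is_derive R R R (cst 0)).
    near=> w; rewrite /profile ltNge (_ : w <= 0)//.
    by near: w; exact: lt_le_nbhsl.
- apply: (@near_eq_is_derive R R R (fun w => P.[w^-1] * expR (- w^-1))).
    near=> w; rewrite /profile (_ : 0 < w)//.
    by near: w; exact: lt_nbhsr.
  have dinv : is_derive z 1 (fun w : R => w^-1) (- z ^- 2).
    apply: is_derive_eq; first by apply: is_deriveV; rewrite gt_eqF.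
    by rewrite [_%:A]mulr1.
  have dP : is_derive z 1 (fun w => P.[w^-1]) (P^`().[z^-1] * - z ^- 2).
    by apply: is_derive_eq; rewrite // mulrC.
  have dE : is_derive z 1 (fun w => expR (- w^-1)) (expR (- z^-1) * z ^- 2).
    by apply: is_derive_eq; rewrite // opprK mulrC.
  apply: is_derive_eq.
  rewrite /profile z0 /profile_deriv !hornerE /GRing.scale /= exprVn; ring.
(* By [profileMX] the difference quotient at 0 is [profile ('X * P)], which is continuous there with
   value 0. *)
- apply/is_derive1_caratheodory; exists (profile ('X * P)); split.
  + by move=> w; rewrite subr0 [in X in _ - X]/profile ltxx subr0 mulrC -profileMX.
  + exact: profile_cvg0.
  + by rewrite /profile ltxx.
Unshelve. all: by end_near. Qed.

Lemma profile_continuous P : continuous (profile P).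
Proof.
move=> z; apply: differentiable_continuous; apply/derivable1_diffP.
exact: (@ex_derive _ _ _ _ _ _ _ (is_derive_profile P z)).
Qed.

Lemma profile_ge0 P z : (forall y, 0 < y -> 0 <= P.[y]) -> 0 <= profile P z.
Proof.
by move=> P0; rewrite /profile; case: ifPn => // z0; rewrite mulr_ge0 ?expR_ge0// P0 ?invr_gt0.
Qed.

(** Tangent inequality at [x] for the convex function [z e^(-1/z)], extended by 0. For positive [x]
    and [y], division by [e^(-1/x)] reduces it to [1 + t <= e^t] at [t = 1/x - 1/y]. *)
Lemma profile_convex x y :
  x * profile 1 x - y * profile 1 y <= (x - y) * profile (1 + 'X) x.
Proof.
rewrite /profile !hornerE; case: ifPn => x0; last first.
  rewrite !mulr0 add0r oppr_le0; case: ifPn => y0; last by rewrite mulr0.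
  by rewrite mulr_ge0 ?expR_ge0 ?ltW.
have ? := expR_gt0 (- x^-1).
have xx : x * x^-1 = 1 by rewrite mulfV// gt_eqF.
have ? : 0 < x^-1 by rewrite invr_gt0.
case: ifPn => y0; last first.
  rewrite -leNgt in y0; rewrite mulr0 subr0.
  have -> : (x - y) * ((1 + x^-1) * expR (- x^-1)) =
      x * expR (- x^-1) + (x * x^-1 - y * (1 + x^-1)) * expR (- x^-1) by ring.
  by rewrite lerDl mulr_ge0 ?ltW// xx; nra.
have yy : y * y^-1 = 1 by rewrite mulfV// gt_eqF.
have -> : expR (- y^-1) = expR (x^-1 - y^-1) * expR (- x^-1).
  by rewrite -expRD; congr expR; ring.
have := expR_ge1Dx (x^-1 - y^-1); set E := expR (x^-1 - y^-1) => hE.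
rewrite -subr_ge0.
have -> : (x - y) * ((1 + x^-1) * expR (- x^-1)) -
    (x * expR (- x^-1) - y * (E * expR (- x^-1))) =
  (y * (E - (1 + (x^-1 - y^-1))) + (x * x^-1 - y * y^-1)) * expR (- x^-1) by ring.
by rewrite xx yy subrr addr0 mulr_ge0 ?expR_ge0// mulr_ge0 ?subr_ge0// ltW.
Qed.

End bump_profile.

Section excess_function.
Variable R : realType.
Implicit Types (x y z : R).

Definition excess z : R := profile (1 + 'X) (z - 1) - profile (1 + 'X) (- z - 1).

Definition excess_slope z : R := profile 'X^3 (z - 1) + profile 'X^3 (- z - 1).

(* For [y > 0] the derivative of [y e^(-1/y)] is [(1 + 1/y) e^(-1/y)]; the numerator [1 + 'X] of
   [excess] comes from this convex primitive. *)
Definition excess_primitive z : R :=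
  (z - 1) * profile 1 (z - 1) + (- z - 1) * profile 1 (- z - 1).

Lemma profile_deriv1X : profile_deriv (1 + 'X : {poly R}) = 'X^3.
Proof.
by rewrite /profile_deriv derivD derivX derivC add0r -addrA addrC subrK -exprSr.
Qed.

Lemma is_derive_excess z : is_derive z 1 excess (excess_slope z).
Proof.
rewrite /excess.
have d1 := is_derive_profile (1 + 'X) (z - 1).
have d2 := is_derive_profile (1 + 'X) (- z - 1).
rewrite profile_deriv1X in d1 d2.
have c1 : is_derive z 1 (fun z : R => z - 1) 1 by apply: is_derive_eq; rewrite ?subr0.
have c2 : is_derive z 1 (fun z : R => - z - 1) (- 1) by apply: is_derive_eq; rewrite ?subr0.
have e1 := @is_derive1_comp _ _ (fun z : R => z - 1) _ _ _ d1 c1.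
have e2 := @is_derive1_comp _ _ (fun z : R => - z - 1) _ _ _ d2 c2.
have := is_deriveB e1 e2; rewrite mulr1 mulrN1 opprK; exact.
Qed.

Lemma excess_continuous : continuous excess.
Proof.
move=> z; apply: differentiable_continuous; apply/derivable1_diffP.
exact: (@ex_derive _ _ _ _ _ _ _ (is_derive_excess z)).
Qed.

Lemma excess_primitive_continuous : continuous excess_primitive.
Proof.
have l1 : continuous (fun z : R => z - 1).
  by move=> z; apply: cvgB; [exact: cvg_id|exact: cvg_cst].
have l2 : continuous (fun z : R => - z - 1).
  by move=> z; apply: cvgB; [apply: cvgN; exact: cvg_id|exact: cvg_cst].
have c (l : R -> R) : continuous l -> continuous (fun z : R => l z * profile 1 (l z)).
  move=> cl z; apply: cvgM; first exact: cl.
  exact: (@continuous_comp _ _ _ l (profile 1) z (cl z) (@profile_continuous _ _ _)).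
by move=> z; apply: cvgD; [exact: (c _ l1)|exact: (c _ l2)].
Qed.

Lemma excess_bound : exists2 C : R, 0 <= C & forall z, `|excess z| <= C.
Proof.
have [C C0 hC] := profile_bound (1 + 'X : {poly R}).
exists (C + C); first by rewrite addr_ge0.
by move=> z; apply: le_trans (ler_normB _ _) _; rewrite lerD.
Qed.

Lemma excess_slope_bound : exists2 C : R, 0 <= C & forall z, excess_slope z <= C.
Proof.
have [C C0 hC] := profile_bound ('X^3 : {poly R}).
exists (C + C); first by rewrite addr_ge0.
by move=> z; apply: le_trans (ler_norm _) _; apply: le_trans (ler_normD _ _) _; rewrite lerD.
Qed.

Lemma excess_slope_ge0 z : 0 <= excess_slope z.
Proof. by rewrite addr_ge0// profile_ge0// => y y0; rewrite hornerXn exprn_ge0// ltW. Qed.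

Lemma excess_lipschitz : exists2 C : R, 0 <= C &
  forall x y, `|excess x - excess y| <= C * `|x - y|.
Proof.
have [C C0 hC] := excess_slope_bound; exists C => // x y.
wlog xy : x y / y <= x.
  by move=> h; case: (leP y x) => [/h//|/ltW/h]; rewrite distrC [`|y - x|]distrC.
have [||c _ ->] := @MVT_segment R excess excess_slope y x xy.
- by move=> z _; exact: is_derive_excess.
- by apply: continuous_subspaceT; exact: excess_continuous.
- by rewrite normrM ler_wpM2r// ger0_norm ?excess_slope_ge0.
Qed.

Lemma excess_eq0 z : `|z| <= 1 -> excess z = 0.
Proof.
rewrite ler_norml /excess /profile => /andP[z1 z2].
by rewrite !ifF ?subrr//; apply/negbTE; rewrite -leNgt; lra.
Qed.

Lemma excess0 : excess 0 = 0.
Proof. by rewrite excess_eq0// normr0. Qed.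

Lemma profile1X_gt0 z : 0 < z -> 0 < profile (1 + 'X) z.
Proof.
move=> z0; rewrite /profile z0 !hornerE mulr_gt0 ?expR_gt0//.
by rewrite addr_gt0// invr_gt0.
Qed.

Lemma excess_gt0 z : 1 < z -> 0 < excess z.
Proof.
move=> z1; rewrite /excess {2}/profile ifF; last by apply/negbTE; rewrite -leNgt; lra.
by rewrite subr0 profile1X_gt0// subr_gt0.
Qed.

Lemma excessN z : excess (- z) = - excess z.
Proof. by rewrite /excess opprK opprB. Qed.

Lemma excess_cubic_lt0 z : 1 < `|z| -> (z - z ^+ 3) * excess z < 0.
Proof.
wlog z0 : z / 0 <= z => [h|].
  case: (leP 0 z) => [/h//|/ltW z0]; rewrite -normrN => /h.
  rewrite oppr_ge0 excessN => /(_ z0); congr (_ < 0); ring.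
rewrite ger0_norm// => z1; have := excess_gt0 z1.
rewrite mulrC => ?; rewrite pmulr_rlt0// exprS; nra.
Qed.

Lemma excess_cubic_le0 z : (z - z ^+ 3) * excess z <= 0.
Proof.
have [z1|/excess_cubic_lt0/ltW//] := leP `|z| 1.
by rewrite excess_eq0// mulr0.
Qed.

Lemma excess_primitive_ge0 z : 0 <= excess_primitive z.
Proof.
have h (x : R) : 0 <= x * profile 1 x.
  have [x0|x0] := leP x 0; first by rewrite /profile ltNge x0 mulr0.
  by rewrite mulr_ge0 ?ltW// /profile x0 hornerE mul1r expR_gt0.
by rewrite addr_ge0.
Qed.

Lemma excess_primitive_eq0 z : `|z| <= 1 -> excess_primitive z = 0.
Proof.
rewrite ler_norml /excess_primitive /profile => /andP[z1 z2].
by rewrite !ifF ?mulr0 ?addr0//; apply/negbTE; rewrite -leNgt; lra.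
Qed.

Lemma excess_primitive_convex x y :
  excess_primitive x - excess_primitive y <= (x - y) * excess x.
Proof.
have := lerD (profile_convex (x - 1) (y - 1)) (profile_convex (- x - 1) (- y - 1)).
rewrite /excess_primitive /excess.
set a := profile 1 _; set b := profile 1 _; set c := profile 1 _; set e := profile 1 _.
set A := profile _ _; set B := profile _ _; lra.
Qed.

End excess_function.
Arguments excess {R} z.
Arguments excess_slope {R} z.
Arguments excess_primitive {R} z.

(** * Test functions *)

Section directional.
Variables (R : realType) (V : normedModType R).
Implicit Types (f : V -> R) (x v : V).

(** Smoothness provides only directional derivatives along the coordinates; restriction to a line
    makes the one-dimensional chain rule applicable without Fréchet differentiability. *)
Lemma is_derive_lineP f x v (df : R) :
  is_derive x v f df <-> is_derive (0 : R) (1 : R) (fun h : R => f (h *: v + x)) df.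
Proof.
have E : (fun h : R => h^-1 *: ((f \o shift x) (h *: v) - f x)) =
    (fun h : R => h^-1 *: (((fun h : R => f (h *: v + x)) \o shift (0 : R)) (h *: (1 : R))
       - f (0 *: v + x))).
  by apply/funext => h /=; rewrite addr0 scale0r add0r [_%:A]mulr1.
by split => -[h1 h2]; apply: DeriveDef; move: h1 h2; rewrite /derivable /derive E.
Qed.

Lemma is_derive_comp1 f (p : R -> R) x v (df dp : R) :
  is_derive x v f df -> is_derive (f x) 1 p dp ->
  is_derive x v (p \o f) (dp * df).
Proof.
move=> /is_derive_lineP hf hp; apply/is_derive_lineP.
apply: (@is_derive1_comp _ p (fun h : R => f (h *: v + x))) => //.
by rewrite scale0r add0r.
Qed.

End directional.

Section test_functions.
Variables (R : realType) (d : nat).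
Local Notation E := 'rV[R]_d.
Local Notation mu := (lebesgue_row d).
Implicit Types (Omega : set E) (f g phi eta : E -> R).

(* Partial derivatives stay in this class, so all its members are smooth. *)
Inductive profile_class phi : (E -> R) -> Prop :=
| profile_class_partials s : profile_class phi (partials s phi)
| profile_class_cst (c : R) : profile_class phi (cst c)
| profile_class_profile P (a b : R) :
    profile_class phi (fun x => profile P (a * phi x + b))
| profile_class_add f g : profile_class phi f -> profile_class phi g ->
    profile_class phi (fun x => f x + g x)
| profile_class_mul f g : profile_class phi f -> profile_class phi g ->
    profile_class phi (fun x => f x * g x).

Lemma is_derive_profile_affine phi P (a b dphi : R) (x v : E) :
  is_derive x v phi dphi ->
  is_derive x v (fun x => profile P (a * phi x + b))
    (profile (profile_deriv P) (a * phi x + b) * (a * dphi)).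
Proof.
move=> dp; apply: (@is_derive_comp1 _ _ (fun x => a * phi x + b)); last exact: is_derive_profile.
have h : is_derive (phi x) 1 (fun z : R => a * z + b) a.
  by apply: is_derive_eq; rewrite [_%:A]mulr1 addr0.
exact: (is_derive_comp1 dp h).
Qed.

Lemma profile_class_smooth1 phi f : smooth phi -> profile_class phi f ->
  continuous f /\ forall i, (forall x, derivable f x (delta_mx ord0 i)) /\
    profile_class phi (partial i f).
Proof.
move=> sphi; elim => {f}.
- move=> s; split=> [x|i]; first by have [] := sphi s x.
  split=> [x|]; first by have [_] := sphi s x; apply.
  exact: (profile_class_partials phi (i :: s)).
- move=> c; split=> [|i]; first exact: (@cst_continuous E R c).
  split=> [x|]; first exact: derivable_cst.
  rewrite (_ : partial i (cst c) = cst 0); first exact: profile_class_cst.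
  by apply/funext => x; rewrite /partial derive_cst.
- move=> P a b.
  have dp i x : is_derive x (delta_mx ord0 i) phi (partial i phi x).
    by apply: derivableP; have [_] := sphi [::] x; apply.
  split=> [x|i].
    have cp : continuous (fun z : R => profile P (a * z + b)).
      move=> z; apply: (@continuous_comp _ _ _ (fun z : R => a * z + b) (profile P)).
        by apply: cvgD; [apply: cvgM; [exact: cvg_cst|exact: cvg_id]|exact: cvg_cst].
      exact: profile_continuous.
    by apply: (@continuous_comp _ _ _ phi _ x _ (cp _)); have [] := sphi [::] x.
  split=> [x|]; first by case: (is_derive_profile_affine P a b (dp i x)).
  rewrite (_ : partial i _ = fun x =>
      profile (profile_deriv P) (a * phi x + b) * (a * partial i phi x)).
    apply: profile_class_mul; first exact: profile_class_profile.
    apply: profile_class_mul; first exact: profile_class_cst.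
    exact: (profile_class_partials phi [:: i]).
  by apply/funext => x; case: (is_derive_profile_affine P a b (dp i x)).
- move=> f g _ [cf hf] _ [cg hg]; split=> [x|i].
    exact: (@continuousD _ _ _ f g x (cf x) (cg x)).
  have [df pf] := hf i; have [dg pg] := hg i.
  split=> [x|]; first exact: (@derivableD _ _ _ f g x _ (df x) (dg x)).
  rewrite (_ : partial i _ = fun x => partial i f x + partial i g x).
    exact: profile_class_add.
  by apply/funext => x; exact: (@deriveD _ _ _ f g x _ (df x) (dg x)).
- move=> f g Cf [cf hf] Cg [cg hg]; split=> [x|i].
    exact: (@continuousM _ _ f g x (cf x) (cg x)).
  have [df pf] := hf i; have [dg pg] := hg i.
  split=> [x|]; first exact: (@derivableM _ _ f g x _ (df x) (dg x)).
  rewrite (_ : partial i _ = fun x => f x * partial i g x + g x * partial i f x).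
    by apply: profile_class_add; exact: profile_class_mul.
  by apply/funext => x; exact: (@deriveM _ _ f g x _ (df x) (dg x)).
Qed.

Lemma profile_class_smooth phi f : smooth phi -> profile_class phi f -> smooth f.
Proof.
move=> sphi pf s x.
have ps : profile_class phi (partials s f).
  by elim: s => //= i s /(profile_class_smooth1 sphi)[_ /(_ i)[]].
have [c h] := profile_class_smooth1 sphi ps; split; first exact: c.
by move=> i; have [] := h i.
Qed.

Lemma smooth_excess phi : smooth phi -> smooth (excess \o phi).
Proof.
move=> sphi; apply: (profile_class_smooth sphi).
rewrite (_ : _ \o _ = fun x => profile (1 + 'X) (1 * phi x + - 1) +
   cst (- 1) x * profile (1 + 'X) (- 1 * phi x + - 1)).
  apply: profile_class_add; first exact: profile_class_profile.
  by apply: profile_class_mul; [exact: profile_class_cst|exact: profile_class_profile].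
by apply/funext => x /=; rewrite /excess mul1r !mulN1r.
Qed.

Lemma smooth_partial phi i : smooth phi -> smooth (partial i phi).
Proof. by move=> sphi s x; rewrite /partials -foldr_rcons; exact: sphi. Qed.

Lemma smooth_continuous phi : smooth phi -> continuous phi.
Proof. by move=> sphi x; have [] := sphi [::] x. Qed.

Lemma smooth_derivable phi i x : smooth phi -> derivable phi x (delta_mx ord0 i).
Proof. by move=> sphi; have [_] := sphi [::] x; exact. Qed.

Lemma partial_excess phi i x : smooth phi ->
  partial i (excess \o phi) x = excess_slope (phi x) * partial i phi x.
Proof.
move=> sphi; apply: derive_val; apply: is_derive_comp1; last exact: is_derive_excess.
by apply: derivableP; exact: smooth_derivable.
Qed.

Lemma test_function_sub Omega phi f : test_function Omega phi -> smooth f ->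
  (forall x, f x != 0 -> closure [set x | phi x != 0] x) ->
  test_function Omega f.
Proof.
move=> [sphi cphi subO] sf fphi.
have fsub : closure [set x | f x != 0] `<=` closure [set x | phi x != 0].
  rewrite [X in _ `<=` X](closure_id _).1; last exact: closed_closure.
  exact: closure_subset.
split=> //; last exact: subset_trans fsub subO.
exact: subclosed_compact (@closed_closure _ _) cphi fsub.
Qed.

Lemma test_function_excess Omega phi :
  test_function Omega phi -> test_function Omega (excess \o phi).
Proof.
move=> tphi; have [sphi _ _] := tphi.
apply: test_function_sub tphi (smooth_excess sphi) _ => x /= h; apply: subset_closure => /=.
by apply: contraNneq h => ->; rewrite excess0.
Qed.

Lemma test_function_partial Omega phi i :
  test_function Omega phi -> test_function Omega (partial i phi).
Proof.
move=> tphi; have [sphi _ _] := tphi.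
apply: test_function_sub tphi (smooth_partial i sphi) _ => x; apply: contra_neqP => nx.
transitivity ('D_(delta_mx ord0 i) (cst (0 : R)) x); last exact: derive_cst.
apply: near_eq_derive.
have : nbhs x (~` closure [set x | phi x != 0]).
  by apply: open_nbhs_nbhs; split => //; exact/closed_openC/closed_closure.
apply: filterS => y ny; apply/eqP/negPn/negP => hy; apply: ny.
exact: subset_closure.
Qed.

Lemma test_function_support Omega phi : test_function Omega phi ->
  (exists M, forall x, phi x != 0 -> `|x| <= M) /\
  (forall x, phi x != 0 -> Omega x).
Proof.
move=> [_ /compact_bounded[M [_ hM]] subO]; split.
  exists (`|M| + 1) => x px; apply: hM; first by rewrite ltr_pwDr// ler_norm.
  exact: subset_closure.
by move=> x px; apply: subO; exact: subset_closure.
Qed.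

Lemma Rintegral_test Omega (h : E -> R) : (forall x, h x != 0 -> Omega x) ->
  (\int[mu]_(x in Omega) h x = \int[mu]_x h x)%R.
Proof.
move=> hO; rewrite Rintegral_mkcond; congr (Rintegral _ _ _).
apply/funext => x; rewrite patchE; case: ifPn => //; rewrite notin_setE => nx.
by apply/esym/eqP/negPn/negP => /hO.
Qed.

(** Supports inside [Omega] allow both integrals to be taken over the whole space, where the two
    integrands add up to a partial derivative of [phi eta], whose integral is 0. *)
Lemma integration_by_parts_test Omega phi eta i :
  test_function Omega phi -> test_function Omega eta ->
  (\int[mu]_(x in Omega) (phi x * partial i eta x) =
   - \int[mu]_(x in Omega) (partial i phi x * eta x))%R.
Proof.
move=> tphi teta.
have [[sphi _ _] [seta _ _]] := (tphi, teta).
have [[M hM] hO] := test_function_support tphi.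
have [[M' hM'] hO'] := test_function_support teta.
have supp (f g : E -> R) (P : E -> Prop) : (forall x, f x != 0 -> P x) ->
    forall x, f x * g x != 0 -> P x.
  by move=> h x; rewrite mulf_eq0 negb_or => /andP[/h].
have supp' (f g : E -> R) (P : E -> Prop) : (forall x, g x != 0 -> P x) ->
    forall x, f x * g x != 0 -> P x.
  by move=> h x; rewrite mulf_eq0 negb_or => /andP[_ /h].
have cM (f g : E -> R) : continuous f -> continuous g -> continuous (fun x => f x * g x).
  by move=> cf cg x; exact: (@continuousM _ _ f g x (cf x) (cg x)).
have pE : partial i (fun x => phi x * eta x) =
    fun x => phi x * partial i eta x + partial i phi x * eta x.
  apply/funext => x; rewrite [in RHS](mulrC (partial i phi x)).
  by apply: deriveM; exact: smooth_derivable.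
have i1 := compact_support_integrable
  (cM _ _ (smooth_continuous sphi) (smooth_continuous (smooth_partial i seta))) (supp _ _ _ hM).
have i2 := compact_support_integrable
  (cM _ _ (smooth_continuous (smooth_partial i sphi)) (smooth_continuous seta)) (supp' _ _ _ hM').
have h1 := supp _ (partial i eta) _ hO.
have h2 := supp' (partial i phi) _ _ hO'.
rewrite (Rintegral_test h1) (Rintegral_test h2).
apply/eqP; rewrite -addr_eq0 -RintegralD//.
have := @integral_partial_eq0 R d (fun x => phi x * eta x) i M.
rewrite pE /Rintegral => ->//.
- exact: cM (smooth_continuous sphi) (smooth_continuous seta).
- by move=> x; apply: derivableM; exact: smooth_derivable.
- move=> x; apply: (@continuousD _ _ _ (fun x => phi x * partial i eta x) (fun x => partial i phi x * eta x)).
    exact: (cM _ _ (smooth_continuous sphi) (smooth_continuous (smooth_partial i seta))).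
  exact: (cM _ _ (smooth_continuous (smooth_partial i sphi)) (smooth_continuous seta)).
- exact: supp.
Qed.

End test_functions.

(** * Square-integrable functions and the weak Laplacian *)

Section L2_space.
Variables (R : realType) (d : nat) (Omega : set 'rV[R]_d).
Local Notation E := 'rV[R]_d.
Local Notation mu := (lebesgue_row d).
Hypothesis mO : measurable Omega.
Implicit Types (f g h : E -> R).

Lemma L2_measurable f : L2 Omega f -> measurable_fun Omega f.
Proof.
move=> /sub_Lfun_mfun; rewrite inE /= => mf.
by apply/(measurable_restrictT _ mO).
Qed.

Lemma L2_mul_integrable f g : L2 Omega f -> L2 Omega g ->
  mu.-integrable Omega (EFin \o (fun x => f x * g x)).
Proof.
move=> lf lg; apply/(integrable_mkcond _ mO).
have /Lfun1_integrable := Lfun2_mul_Lfun1 lf lg.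
congr (_.-integrable _ _); apply/funext => x.
by rewrite /= !patchE; case: ifPn => //; rewrite mul0r.
Qed.

Lemma L2_sqr_integrable f : L2 Omega f ->
  mu.-integrable Omega (EFin \o (fun x => f x ^+ 2)).
Proof. by move=> lf; under eq_fun do rewrite expr2; exact: L2_mul_integrable. Qed.

Lemma L2D f g : L2 Omega f -> L2 Omega g -> L2 Omega (f \+ g).
Proof.
move=> lf lg; rewrite /L2 (_ : _ \_ _ = (f \_ Omega) + (g \_ Omega)) ?rpredD ?lee1n//.
by apply/funext => x; rewrite /GRing.add /= !patchE; case: ifPn => //; rewrite addr0.
Qed.

Lemma L2N f : L2 Omega f -> L2 Omega (\- f).
Proof.
move=> lf; rewrite /L2 (_ : _ \_ _ = - (f \_ Omega)) ?rpredN ?lee1n//.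
by apply/funext => x; rewrite /GRing.opp /= !patchE; case: ifPn => //; rewrite oppr0.
Qed.

Lemma L2B f g : L2 Omega f -> L2 Omega g -> L2 Omega (f \- g).
Proof. by move=> lf lg; exact: L2D lf (L2N lg). Qed.

Lemma L2norm_sqr f : (L2norm Omega f `^ 2 = \int[mu]_(x in Omega) (f x ^+ 2)%:E)%E.
Proof.
rewrite /L2norm poweR_Lnorm// [RHS]integral_mkcond; apply: eq_integral => x _ /=.
rewrite !patchE; case: ifPn => _.
  by rewrite powR_mulrn// real_normK ?num_real.
by rewrite -[point]/(0 : R) normr0 powR0.
Qed.

Lemma L2norm_lt f (e : R) : L2 Omega f -> 0 <= e -> (L2norm Omega f < e%:E)%E ->
  \int[mu]_(x in Omega) (f x ^+ 2) <= e ^+ 2.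
Proof.
move=> lf e0 fe.
rewrite -lee_fin /Rintegral fineK; last exact/integrable_fin_num/L2_sqr_integrable.
rewrite -L2norm_sqr -powR_mulrn// -poweR_EFin.
apply: gt0_ler_poweR; rewrite ?in_itv /= ?leey ?andbT //; [exact: Lnorm_ge0|exact: ltW].
Qed.

Hypothesis fO : (mu Omega < +oo)%E.

Lemma L2_bounded f (C : R) : measurable_fun Omega f -> (forall x, Omega x -> `|f x| <= C) ->
  L2 Omega f.
Proof.
move=> mf fC; rewrite /L2 inE; apply/andP; split.
  by rewrite inE /=; apply/(measurable_restrictT _ mO).
rewrite inE /= /finite_norm; apply: (@lty_poweRy _ _ 2) => //.
have -> := L2norm_sqr f.
apply: (@le_lt_trans _ _ (\int[mu]_(x in Omega) (cst (C ^+ 2)%:E) x)%E).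
  apply: ge0_le_integral => //.
  - by move=> x _; rewrite lee_fin sqr_ge0.
  - by apply/measurable_EFinP; exact: measurable_funX.
  - by move=> x Ox; rewrite lee_fin -[f x ^+ 2]real_normK ?num_real// lerXn2r ?nnegrE//
      ?fC// (le_trans _ (fC x Ox)).
rewrite integral_cst//= lte_mul_pinfty ?lee_fin ?sqr_ge0//.
Qed.

End L2_space.

(** * Sign of the weak Laplacian tested with the excess *)

Section weak_laplacian_excess.
Variables (R : realType) (d : nat) (Omega : set 'rV[R]_d).
Local Notation E := 'rV[R]_d.
Local Notation mu := (lebesgue_row d).
Hypothesis mO : measurable Omega.
Hypothesis fO : (mu Omega < +oo)%E.
Implicit Types (f g phi eta : E -> R).

Lemma L2_test phi : test_function Omega phi -> L2 Omega phi.
Proof.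
move=> tphi; have [[M hM] _] := test_function_support tphi.
have [sphi _ _] := tphi.
have [C C0 hC] := compact_support_bounded (smooth_continuous sphi) hM.
apply: (@L2_bounded _ _ _ mO fO _ C) => //.
by apply: measurable_funTS; exact: continuous_measurable_row (smooth_continuous sphi).
Qed.

Lemma weak_partialP i f : weak_partials Omega i f !=set0 ->
  weak_partials Omega i f (weak_partial Omega i f).
Proof. by move=> [g fg]; exact: (@xgetPex _ (cst 0) _ (ex_intro _ g fg)). Qed.

Lemma weak_partialsB i f g phi : L2 Omega f ->
  weak_partials Omega i f g -> test_function Omega phi ->
  weak_partials Omega i (f \- phi) (g \- partial i phi).
Proof.
move=> lf [lg hg] tphi; have tp := test_function_partial i tphi.
split; first exact: L2B lg (L2_test tp).
move=> eta teta; have te := test_function_partial i teta.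
have i1 := L2_mul_integrable mO lf (L2_test te).
have i2 := L2_mul_integrable mO (L2_test tphi) (L2_test te).
have i3 := L2_mul_integrable mO lg (L2_test teta).
have i4 := L2_mul_integrable mO (L2_test tp) (L2_test teta).
under eq_Rintegral do rewrite /= mulrBl.
under [X in _ = - X]eq_Rintegral do rewrite /= mulrBl.
by rewrite !RintegralB// hg// integration_by_parts_test// opprB opprK addrC.
Qed.

(* [excess \o phi] has partial [excess_slope(phi) phi'], and completing the square gives
   [excess_slope(phi) f' phi' >= - C/4 (f' - phi')^2]. *)
Lemma weak_partial_excess i f phi (C e : R) :
  L2 Omega f -> weak_partials Omega i f !=set0 -> test_function Omega phi ->
  (forall z : R, excess_slope z <= C) -> 0 <= e ->
  (L2norm Omega (weak_partial Omega i (f \- phi)%R) < e%:E)%E ->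
  - (C / 4 * e ^+ 2) <=
    \int[mu]_(x in Omega) (weak_partial Omega i f x * partial i (excess \o phi) x).
Proof.
move=> lf fi tphi hC e0 pe.
have wf := weak_partialP fi.
have wp : weak_partials Omega i (f \- phi)%R (weak_partial Omega i (f \- phi)%R).
  by apply: weak_partialP; eexists; exact: weak_partialsB lf wf tphi.
set p := weak_partial Omega i (f \- phi)%R in pe wp *.
set fi' := weak_partial Omega i f in wf *.
set eta := partial i (excess \o phi).
have teta : test_function Omega eta by exact: test_function_partial (test_function_excess tphi).
have [sphi _ _] := tphi.
have etaE x : eta x = excess_slope (phi x) * partial i phi x by exact: partial_excess.
clearbody eta.
have te := test_function_partial i teta.
have tp := test_function_partial i tphi.
have [lp hp] := wp; have [lg hg] := wf.
have i1 := L2_mul_integrable mO lf (L2_test te).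
have i2 := L2_mul_integrable mO (L2_test tphi) (L2_test te).
have i3 := L2_mul_integrable mO lp (L2_test teta).
have i4 := L2_mul_integrable mO (L2_test tp) (L2_test teta).
have fE : \int[mu]_(x in Omega) (fi' x * eta x) =
    \int[mu]_(x in Omega) (p x * eta x + partial i phi x * eta x).
  have := hp _ teta; under eq_Rintegral do rewrite /= mulrBl.
  rewrite RintegralB// hg// integration_by_parts_test// RintegralD//; lra.
rewrite fE.
have C0 : 0 <= C by exact: le_trans (excess_slope_ge0 0) (hC 0).
apply: (@le_trans _ _ (\int[mu]_(x in Omega) (- (C / 4) * p x ^+ 2))).
  rewrite RintegralZl//; last exact: L2_sqr_integrable.
  by rewrite mulNr lerN2 ler_wpM2l ?divr_ge0//; exact: L2norm_lt.
apply: le_Rintegral => //.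
- have := integrableZl mO (- (C / 4)) (L2_sqr_integrable mO lp).
  by congr (_.-integrable _ _); apply/funext => x /=; rewrite EFinM.
- have := integrableD mO i3 i4.
  by congr (_.-integrable _ _); apply/funext => x /=; rewrite EFinD.
- move=> x Ox; rewrite etaE.
  have := excess_slope_ge0 (phi x); have := hC (phi x).
  set s := excess_slope _; set a := partial i phi x; set b := p x => sC s0.
  have -> : b * (s * a) + a * (s * a) = s * (a + b / 2) ^+ 2 - s / 4 * b ^+ 2 by field.
  have ? := mulr_ge0 s0 (sqr_ge0 (a + b / 2)).
  have : s / 4 * b ^+ 2 <= C / 4 * b ^+ 2 by rewrite ler_wpM2r ?sqr_ge0// ler_pM2r.
  lra.
Qed.

Lemma L2_sum (I : Type) (r : seq I) (F : I -> E -> R) :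
  (forall i, L2 Omega (F i)) -> L2 Omega (fun x => \sum_(i <- r) F i x).
Proof.
move=> lF; elim: r => [|i r IH].
  under eq_fun do rewrite big_nil.
  by apply: (@L2_bounded _ _ _ mO fO _ 0) => // x _; rewrite normr0.
under eq_fun do rewrite big_cons.
exact: L2D (lF i) IH.
Qed.

Lemma L2_weak_laplacian f : H2 Omega f -> L2 Omega (weak_laplacian Omega f).
Proof.
move=> [_ hf]; apply: L2_sum => i.
by have [_ /(_ i)/weak_partialP[]] := hf i.
Qed.

Lemma L2_excess f : measurable_fun Omega f -> L2 Omega (excess \o f).
Proof.
move=> mf; have [C C0 hC] := excess_bound R.
apply: (@L2_bounded _ _ _ mO fO _ C) => [|x _]; last exact: hC.
apply: measurableT_comp mf; apply: continuous_measurable_fun; exact: excess_continuous.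
Qed.

Lemma Rintegral_sum (I : Type) (r : seq I) (F : I -> E -> R) :
  (forall i, mu.-integrable Omega (EFin \o F i)) ->
  \int[mu]_(x in Omega) (\sum_(i <- r) F i x) = \sum_(i <- r) \int[mu]_(x in Omega) F i x.
Proof.
move=> iF; elim: r => [|i r IH].
  under eq_Rintegral do rewrite big_nil.
  by rewrite big_nil Rintegral_cst// mul0r.
under eq_Rintegral do rewrite big_cons.
rewrite RintegralD// ?IH ?big_cons//.
have := integrable_sum mO r (P := xpredT) (fun i _ => iF i).
by congr (_.-integrable _ _); apply/funext => x /=; rewrite sumEFin.
Qed.

(** A test function [phi] at H^1 distance less than [e] costs two errors: at most [C/4 e^2] per
    coordinate in the gradient term, and [e (A/2 + L^2/2)] for replacing [excess f] by [excess phi],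
    from the Lipschitz bound and Young's inequality with weight [e]. Both vanish with [e]. *)
Lemma weak_laplacian_excess_le0 f : H2 Omega f -> H10 Omega f ->
  \int[mu]_(x in Omega) (weak_laplacian Omega f x * excess (f x)) <= 0.
Proof.
move=> H2f [[lf wf] app].
have lD := L2_weak_laplacian H2f; set D := weak_laplacian Omega f in lD *.
have [C C0 hC] := excess_slope_bound R.
have [L L0 hL] := excess_lipschitz R.
pose A := \int[mu]_(x in Omega) (D x ^+ 2).
have mf := L2_measurable mO lf.
have lef := L2_excess mf.
suff h (e : R) : 0 < e -> e < 1 -> \int[mu]_(x in Omega) (D x * excess (f x)) <=
    e * (C / 4 * d%:R + A / 2 + L ^+ 2 / 2).
  set K := _ + L ^+ 2 / 2 in h; set S := \int[mu]_(x in Omega) _ in h *.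
  have A0 : 0 <= A by apply: Rintegral_ge0 => x _; exact: sqr_ge0.
  have K0 : 0 <= K.
    have ? : 0 <= C / 4 * d%:R by rewrite mulr_ge0// divr_ge0.
    have ? := sqr_ge0 L; rewrite /K; lra.
  rewrite leNgt; apply/negP => S0.
  have N0 : 0 < S + K + 1 by lra.
  (* At this [e], which is below 1, the bound [S <= e K] would give [S (S + 1) <= 0]. *)
  have := h (S / (S + K + 1)); rewrite divr_gt0// ltr_pdivrMr// mul1r.
  have -> : S < S + K + 1 by lra.
  by move=> /(_ isT isT); rewrite mulrAC ler_pdivlMr//; nra.
move=> e0 e1.
have [phi tphi fphi] := app e e0.
have norm_ge0 g : (0 <= L2norm Omega g)%E by exact: Lnorm_ge0.
have fphi0 : (L2norm Omega (f \- phi)%R < e%:E)%E.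
  by apply: le_lt_trans fphi; rewrite leeDl// sume_ge0.
have fphii i : (L2norm Omega (weak_partial Omega i (f \- phi)%R) < e%:E)%E.
  apply: le_lt_trans fphi; rewrite /H1norm (bigD1 i)//= addeCA leeDl//.
  by rewrite adde_ge0// sume_ge0.
have ltp := L2_test (test_function_excess tphi).
have i1 := L2_mul_integrable mO lD lef.
have i2 := L2_mul_integrable mO lD ltp.
have hlap : \int[mu]_(x in Omega) (D x * (excess \o phi) x) <= C / 4 * d%:R * e ^+ 2.
  have lDi i : L2 Omega (weak_partial Omega i (weak_partial Omega i f)).
    by have [_ hf] := H2f; have [_ /(_ i)/weak_partialP[]] := hf i.
  under eq_Rintegral do rewrite /D /weak_laplacian mulr_suml.
  rewrite Rintegral_sum => [|i]; last exact: L2_mul_integrable (lDi i) ltp.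
  apply: (@le_trans _ _ (\sum_(i < d) (C / 4 * e ^+ 2))); last first.
    by rewrite sumr_const card_ord -[leLHS]mulr_natr [leRHS]mulrAC.
  apply: ler_sum => i _.
  have := weak_partial_excess lf (wf i) tphi hC (ltW e0) (fphii i).
  have [_ hf] := H2f; have [_ /(_ i)/weak_partialP[_ hw]] := hf i.
  by rewrite hw ?lerN2//; exact: test_function_excess.
pose r x := (f x - phi x) ^+ 2.
have lfp := L2B lf (L2_test tphi).
have ir : mu.-integrable Omega (EFin \o r) by exact: L2_sqr_integrable lfp.
have iD := L2_sqr_integrable mO lD.
have hr : \int[mu]_(x in Omega) r x <= e ^+ 2 by exact: L2norm_lt lfp (ltW e0) fphi0.
have iZ k (g : E -> R) : mu.-integrable Omega (EFin \o g) ->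
    mu.-integrable Omega (EFin \o (fun x => k * g x)).
  move=> /(integrableZl mO k).
  by congr (_.-integrable _ _); apply/funext => x /=; rewrite EFinM.
have hdiff : \int[mu]_(x in Omega) (D x * excess (f x)) -
    \int[mu]_(x in Omega) (D x * (excess \o phi) x) <=
    e / 2 * A + L ^+ 2 / (2 * e) * \int[mu]_(x in Omega) r x.
  rewrite -RintegralB// -!RintegralZl// -RintegralD//; [|exact: iZ|exact: iZ].
  apply: le_Rintegral => //.
  - have := integrableB mO i1 i2.
    by congr (_.-integrable _ _); apply/funext => x /=; rewrite EFinB.
  - have := integrableD mO (iZ (e / 2) _ iD) (iZ (L ^+ 2 / (2 * e)) _ ir).
    by congr (_.-integrable _ _); apply/funext => x /=; rewrite EFinD.
  - move=> x _ /=; rewrite -mulrBr.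
    have := hL (f x) (phi x); rewrite /r.
    set a := D x; set b := excess _ - _; set c := f x - phi x => bc.
    have b2 : b ^+ 2 <= L ^+ 2 * c ^+ 2.
      rewrite -(real_normK (num_real b)) -(real_normK (num_real c)) -exprMn.
      by rewrite lerXn2r// ?nnegrE// mulr_ge0.
    (* Young's inequality [a b <= e/2 a^2 + b^2/(2e)] *)
    have -> : L ^+ 2 / (2 * e) * c ^+ 2 = (L ^+ 2 * c ^+ 2) / (2 * e) by field; rewrite gt_eqF.
    apply: (@le_trans _ _ (e / 2 * a ^+ 2 + b ^+ 2 / (2 * e))); last first.
      by rewrite lerD2l ler_wpM2r// invr_ge0 mulr_ge0// ltW.
    rewrite -subr_ge0.
    have -> : e / 2 * a ^+ 2 + b ^+ 2 / (2 * e) - a * b = (e * a - b) ^+ 2 / (2 * e).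
      by field; rewrite gt_eqF.
    by rewrite divr_ge0 ?sqr_ge0// mulr_ge0// ltW.
have h3 : L ^+ 2 / (2 * e) * \int[mu]_(x in Omega) r x <= e * (L ^+ 2 / 2).
  apply: le_trans (ler_wpM2l _ hr) _; first by rewrite divr_ge0 ?sqr_ge0// mulr_ge0// ltW.
  by rewrite le_eqVlt; apply/orP; left; apply/eqP; field; rewrite gt_eqF.
have h4 : C / 4 * d%:R * e ^+ 2 <= C / 4 * d%:R * e.
  rewrite ler_wpM2l ?mulr_ge0 ?divr_ge0//.
  by rewrite expr2 ler_piMl// ltW.
lra.
Qed.

End weak_laplacian_excess.

(** * Energy of the Caputo derivative *)

Section translation.
Variable R : realType.
Local Notation leb := (@lebesgue_measure R).

Lemma measurable_shift (s : R) :
  measurable_fun [set: measurableTypeR R]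
    (fun t : measurableTypeR R => t - s : measurableTypeR R).
Proof. exact: measurable_funB. Qed.

Lemma lebesgue_measure_shift (s : R) (A : set R) : measurable A ->
  pushforward leb (fun t => t - s : measurableTypeR R) A = leb A.
Proof.
move=> mA; apply/esym; apply: (lebesgue_measure_unique
  (mu := pushforward leb (fun t => t - s : measurableTypeR R))) => //.
- exact: measurable_shift.
- move=> ms _ [[a b]] _ <-.
have E : (fun t : R => t - s) @^-1` `]a, b]%classic = `]a + s, b + s]%classic.
  by apply/seteqP; split => x /=; rewrite !in_itv /= ltrBrDr lerBlDr.
transitivity (leb `]a + s, b + s]%classic); last by rewrite -E.
rewrite !lebesgue_measure_itv/= !lte_fin ltrD2r -!EFinB.
by rewrite opprD addrACA subrr addr0.
Qed.

Lemma ge0_integral_shift (s : R) (f : R -> \bar R) : measurable_fun setT f ->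
  (forall x, 0 <= f x)%E -> (\int[leb]_t f (t - s)%R = \int[leb]_t f t)%E.
Proof.
move=> mf f0.
have := @ge0_integral_pushforward _ _ _ _ _ _ (measurable_shift s) leb setT f measurableT mf (fun x _ => f0 x).
rewrite preimage_setT => <-; apply: eq_measure_integral => [|ms A mA _].
  exact: measurable_shift.
exact: lebesgue_measure_shift.
Qed.

End translation.

(** * The singular kernel and its superlevel sets *)

Section kernel.
Variables (R : realType) (alpha : R).
Hypothesis halpha : 0 < alpha < 1.
Local Notation leb := (@lebesgue_measure R).

(** Vanishing for [r <= 0] turns the integral over [0, t] into a convolution on the whole line. *)
Definition caputo_kernel (r : R) : R := if 0 < r then r `^ (- alpha) else 0.

Lemma caputo_kernel_ge0 r : 0 <= caputo_kernel r.
Proof. by rewrite /caputo_kernel; case: ifPn => // _; rewrite powR_ge0. Qed.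

Lemma measurable_caputo_kernel : measurable_fun [set: R] caputo_kernel.
Proof.
apply: measurable_fun_ifT => //; first exact: measurable_fun_ltr.
Qed.

Lemma caputo_kernel_level (h r : R) : 0 < h ->
  (h < caputo_kernel r) = (0 < r < h `^ (- alpha^-1)).
Proof.
have /andP[a0 a1] := halpha.
move=> h0; rewrite /caputo_kernel; case: ifPn => //= r0; last by rewrite ltNge (ltW h0).
have rE : h `^ (- alpha^-1) `^ (- alpha) = h.
  by rewrite -powRrM mulrNN mulVf ?gt_eqF// powRr1// ltW.
have := powR_gt0 (- alpha^-1) h0; set rho := h `^ (- alpha^-1) in rE * => rho0.
rewrite -[in LHS]rE !powRN ltf_pV2 ?posrE ?powR_gt0//.
apply/idP/idP => [|rh]; last by apply: (gt0_ltr_powR a0) => //; rewrite nnegrE ltW.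
apply: contraLR; rewrite -!leNgt => hr.
by apply: (ge0_ler_powR (ltW a0)) => //; rewrite nnegrE ltW.
Qed.

(** The kernel is unbounded near 0, so the antiderivative [r^(1-alpha)/(1-alpha)] is used on
    [[1/(n+1), T]]. Its value at [T] bounds all these integrals, and monotone convergence
    concludes. *)
Lemma integral_caputo_kernel_lty (T : R) :
  (\int[leb]_(r in `]0%R, T]) (caputo_kernel r)%:E < +oo)%E.
Proof.
have /andP[a0 a1] := halpha.
pose F n := `[(n.+1%:R^-1 : R), T]%classic.
have FE : `]0%R, T]%classic = \bigcup_n F n.
  apply/seteqP; split => x /=; rewrite in_itv /=.
    move=> /andP[x0 xT]; have [n _ /(_ n) h] := near_infty_natSinv_lt (PosNum x0).
    by exists n => //; rewrite /F /= in_itv /= xT andbT ltW//; apply: h => /=.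
  by move=> [n _]; rewrite /F /= in_itv /= => /andP[+ ->]; rewrite andbT; apply: lt_le_trans.
pose C := T `^ (1 - alpha) / (1 - alpha).
apply: (@le_lt_trans _ _ C%:E); last exact: ltry.
rewrite FE.
have mK A : measurable_fun A (EFin \o caputo_kernel).
  by apply/measurable_EFinP; apply: measurable_funTS; exact: measurable_caputo_kernel.
have h := @ge0_nondecreasing_set_cvg_integral _ (measurableTypeR R) R F
  (EFin \o caputo_kernel) leb _ _ (fun i => mK _) (fun n x _ => _).
have {}h : (\int[leb]_(x in F i) (EFin \o caputo_kernel) x @[i --> \oo] -->
   \int[leb]_(x in \bigcup_i F i) (EFin \o caputo_kernel) x)%E.
  apply: h.
  - apply/nondecreasing_seqP => n; apply/subsetPset => x; rewrite /F /= !in_itv /= => /andP[xn ->].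
    by rewrite andbT (le_trans _ xn)// lef_pV2 ?posrE// ler_nat.
  - by move=> n; exact: measurable_itv.
  - by move=> x; rewrite lee_fin caputo_kernel_ge0.
apply: (cvge_to_le h); apply: nearW => n /=.
have n0 : 0 < (n.+1%:R^-1 : R) by rewrite invr_gt0.
have C0 : 0 <= C by rewrite divr_ge0 ?powR_ge0// subr_ge0 ltW.
have [nT|] := ltP (n.+1%:R^-1 : R) T; last first.
  rewrite le_eqVlt => /predU1P[TE|Tn].
    by rewrite /F -TE set_itv1 integral_set1 lee_fin.
  by rewrite /F set_itv_ge ?integral_set0 ?lee_fin// -leNgt.
pose G := fun r : R => r `^ (1 - alpha) / (1 - alpha).
have dG (x : R) : 0 < x -> is_derive x 1 G (x `^ (- alpha)).
  move=> x0; have d := is_derive1_powR (1 - alpha) x0.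
  rewrite (_ : G = (1 - alpha)^-1 *: ((fun r : R => r `^ (1 - alpha)) : R -> R)); last first.
    by apply/funext => r; rewrite /G mulrC.
  apply: is_derive_eq; rewrite /GRing.scale /= mulrA mulVf ?mul1r ?gt_eqF ?subr_gt0//.
  by congr (x `^ _); ring.
have cont (f : R -> R) (x df : R) : is_derive x 1 f df -> {for x, continuous f}.
  by move=> [dfx _]; apply: differentiable_continuous; exact/derivable1_diffP.
have T0 : 0 < T by exact: lt_trans nT.
have F0 (x : R) : n.+1%:R^-1 <= x -> 0 < x by exact: lt_le_trans.
rewrite (continuous_FTC2 (F := G))//.
- by rewrite -EFinB lee_fin /G /C lerBlDr lerDl divr_ge0 ?powR_ge0// subr_ge0 ltW.
- apply: continuous_in_subspaceT => x; rewrite inE /= in_itv /= => /andP[/F0 x0 _].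
  apply: (cont _ _ (- alpha * x `^ (- alpha - 1))).
  apply: (@near_eq_is_derive R R R (fun r => r `^ (- alpha))); last exact: is_derive1_powR.
  by near=> r; rewrite /caputo_kernel ifT//; near: r; exact: lt_nbhsr.
- split.
  + by move=> x; rewrite in_itv /= => /andP[/ltW/F0/dG[]].
  + by apply: cvg_at_right_filter; exact: cont (dG _ n0).
  + by apply: cvg_at_left_filter; exact: cont (dG _ T0).
- move=> x; rewrite in_itv /= => /andP[/ltW/F0 x0 _].
  by rewrite derive1E /caputo_kernel x0; exact: (@derive_val _ _ _ _ _ _ _ (dG x x0)).
Unshelve. all: by end_near. Qed.

End kernel.

(** * Measurability of parameter integrals and the layer-cake formula *)

Section integral_lemmas.
Context d1 d2 (Y : measurableType d1) (S : measurableType d2) (R : realType).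
Variables (nu : {sigma_finite_measure set Y -> \bar R}).
Variables (m2 : {sigma_finite_measure set S -> \bar R}).
Local Notation leb := (@lebesgue_measure R).

Lemma measurable_fun_Rintegral (f : Y * S -> R) : measurable_fun setT f ->
  measurable_fun setT (fun y => \int[m2]_s f (y, s)).
Proof.
move=> mf.
have mF : measurable_fun setT (EFin \o f) by exact/measurable_EFinP.
rewrite /Rintegral.
under eq_fun do rewrite integralE.
apply: measurableT_comp; first exact: fine_measurable.
apply: emeasurable_funB.
- rewrite (_ : (fun y => _) = fubini_F m2 (EFin \o f)^\+%E); last first.
    by apply/funext => y; rewrite /fubini_F !unlock.
  exact: measurable_fun_fubini_tonelli_F (measurable_funepos mF) (fun z => funepos_ge0 _ z).
- rewrite (_ : (fun y => _) = fubini_F m2 (EFin \o f)^\-%E); last first.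
    by apply/funext => y; rewrite /fubini_F !unlock.
  exact: measurable_fun_fubini_tonelli_F (measurable_funeneg mF) (fun z => funeneg_ge0 _ z).
Qed.

(* [k = \int_0^oo 1_(h < k) dh], then Fubini. *)
Lemma layer_cake_ge0 (k F : Y -> R) : measurable_fun setT k -> measurable_fun setT F ->
  (forall y, 0 <= k y) -> nu.-integrable setT (EFin \o (fun y => k y * F y)) ->
  (forall h, 0 < h -> nu.-integrable setT (EFin \o (fun y => if h < k y then F y else 0)) ->
    (0 <= \int[nu]_y (if h < k y then F y else 0)%:E)%E) ->
  (0 <= \int[nu]_y (k y * F y)%:E)%E.
Proof.
move=> mk mF k0 ikF hF.
pose Theta (z : Y * measurableTypeR R) : R := if (0 < z.2) && (z.2 < k z.1) then F z.1 else 0.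
have mT : measurable_fun setT Theta.
  apply: measurable_fun_ifT => //; last exact: measurableT_comp mF measurable_fst.
  apply: measurable_and; first exact: measurable_fun_ltr.
  by apply: measurable_fun_ltr => //; exact: measurableT_comp mk measurable_fst.
have mTE : measurable_fun setT (EFin \o Theta) by exact/measurable_EFinP.
have inner (c a : R) : 0 <= a ->
    (\int[leb]_h ((if (0 < h) && (h < a) then c else 0)%:E) = (a * c)%:E)%E.
  move=> a0.
  transitivity (\int[leb]_(h in `]0%R, a[) (cst c%:E h))%E.
    rewrite [RHS]integral_mkcond; apply: eq_integral => h _; rewrite patchE.
    by rewrite mem_setE in_itv /=; case: ifPn.
  rewrite integral_cst//= lebesgue_measure_itv/= lte_fin; case: ifPn => [_|].
    by rewrite -EFinB subr0 -EFinM mulrC.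
  by rewrite -leNgt => a0'; rewrite (@le_anti _ _ a 0) ?a0 ?a0'// mul0r mule0.
have iT : (nu \x leb)%E.-integrable setT (EFin \o Theta).
  apply: (@integrable12ltyP _ _ Y (measurableTypeR R) R nu leb _ mTE).2.
  have /integrableP[_] := ikF; apply: le_lt_trans.
  apply: ge0_le_integral => //.
  - by move=> y _; exact: integral_ge0.
  - apply: (@measurable_fun_fubini_tonelli_F _ _ Y (measurableTypeR R) R leb (abse \o (EFin \o Theta))) => //.
      exact: measurableT_comp.
    by move=> z; exact: abse_ge0.
  - apply: measurableT_comp => //; apply/measurable_EFinP; exact: measurable_funM.
  - move=> y _ /=.
    rewrite (_ : (fun h => _) = (fun h => (if (0 < h) && (h < k y) then `|F y| else 0)%:E)); last first.
      by apply/funext => h; rewrite /Theta /=; case: ifPn => // _; rewrite normr0.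
    by rewrite inner// lee_fin normrM (ger0_norm (k0 y)).
have <- : (\int[nu]_y \int[leb]_h (EFin \o Theta) (y, h) = \int[nu]_y (k y * F y)%:E)%E.
  by apply: eq_integral => y _; rewrite /= /Theta /= inner.
have := integral12_prod_meas1 iT; rewrite /fubini_F => ->.
have := integral21_prod_meas1 iT; rewrite /fubini_G => <-.
apply: integral_ge0 => h _ /=; rewrite /Theta /=.
have [h0|h0] := ltP 0 h; last by rewrite integral0_eq// => y _ /=.
apply: hF => //.
(* As in Chebyshev's inequality, [|F| <= h^-1 |k F|] where [h < k]. *)
have := integrableZl measurableT h^-1 ikF; apply: le_integrable => //.
  apply/measurable_EFinP; apply: measurable_fun_ifT => //.
  exact: measurable_fun_ltr.
move=> y _ /=; rewrite lee_fin; case: ifPn => [hk|_]; last by rewrite normr0.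
rewrite !normrM mulrA ler_peMl// (ger0_norm (k0 y)) gtr0_norm ?invr_gt0//.
by rewrite ler_pdivlMl// mulr1 ltW.
Qed.

End integral_lemmas.

(** * Energy of an interval kernel at a fixed point of space *)

Section primitive_energy.
Variables (R : realType) (v : R -> R) (y0 T rho : R).
Local Notation leb := (@lebesgue_measure R).
Hypothesis iv : leb.-integrable setT (EFin \o v).
Hypothesis v0 : forall s, s <= 0 -> v s = 0.
Hypothesis y01 : `|y0| <= 1.
Hypothesis rho0 : 0 < rho.

Let y t := y0 + \int[leb]_(s in `]-oo, t]) v s.

Let iv' A : measurable A -> leb.-integrable A (EFin \o v).
Proof. by move=> mA; exact: integrableS iv. Qed.

Lemma primitive_increment t :
  \int[leb]_(s in `]t - rho, t[) v s = y t - y (t - rho).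
Proof.
have -> : y t - y (t - rho) =
    \int[leb]_(s in `]-oo, t]) v s - \int[leb]_(s in `]-oo, t - rho]) v s.
  by rewrite /y opprD addrACA subrr add0r.
rewrite Rintegral_itvB//; last by rewrite bnd_simp lerBlDr lerDl ltW.
  by rewrite Rintegral_itv_bndo_bndc//; apply: iv'; exact: measurable_itv.
by apply: iv'; exact: measurable_itv.
Qed.

Lemma primitive_start t : t <= 0 -> y t = y0.
Proof.
move=> t0; rewrite /y /Rintegral integral0_eq ?addr0// => s /=.
by rewrite in_itv /= => st; rewrite v0// (le_trans st).
Qed.

Lemma primitive_bound t : `|y t| <= 1 + \int[leb]_s `|v s|.
Proof.
rewrite (le_trans (ler_normD _ _))// lerD//.
have mt : measurable `]-oo, t]%classic by exact: measurable_itv.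
rewrite (le_trans (le_normr_Rintegral _ (iv' mt)))//.
rewrite /Rintegral fine_le ?integrable_fin_num//.
- exact/integrable_norm/iv'.
- exact/integrable_norm/iv.
- apply: ge0_subset_integral => //.
  by have /integrable_norm/measurable_int := iv.
Qed.

Lemma measurable_primitive : measurable_fun setT y.
Proof.
apply: measurable_funD => //.
under eq_fun do rewrite Rintegral_mkcond.
pose f (z : measurableTypeR R * measurableTypeR R) : R := if z.2 <= z.1 then v z.2 else 0.
have mf : measurable_fun setT f.
  apply: measurable_fun_ifT => //; first exact: measurable_fun_ler.
  have mv : measurable_fun setT v by apply/measurable_EFinP; exact: measurable_int iv.
  exact: measurableT_comp mv measurable_snd.
have := measurable_fun_Rintegral leb mf.
apply: eq_measurable_fun => t _; apply: eq_Rintegral => s _.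
by rewrite patchE mem_setE in_itv /=; rewrite /f /=; case: ifPn.
Qed.

(* [excess_primitive] is convex, so the integrand dominates the increment of
   [excess_primitive \o y] over [t - rho, t]; the integral of the increments telescopes, and
   [y = y0] makes the terms at negative times vanish. *)
Lemma primitive_energy_ge0 :
  (0 <= \int[leb]_(t in `]0%R, T[) ((\int[leb]_(s in `]t - rho, t[) v s)%R * excess (y t))%:E)%E.
Proof.
pose G t := excess_primitive (y t).
have [C C0 hC] := excess_bound R.
set M := 1 + \int[leb]_s `|v s|.
have my := measurable_primitive.
have mG : measurable_fun setT G.
  apply: measurableT_comp my; apply: continuous_measurable_fun.
  exact: excess_primitive_continuous.
(* Convexity compared with the point 0, where the primitive vanishes, gives [G <= y excess(y)]. *)
have Gb t : `|G t| <= C * M.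
  rewrite ger0_norm ?excess_primitive_ge0//.
  have := excess_primitive_convex (y t) 0.
  rewrite (excess_primitive_eq0 (z := 0)) ?normr0// !subr0 => h.
  apply: le_trans h _; apply: le_trans (ler_norm _) _; rewrite normrM mulrC.
  by rewrite ler_pM// primitive_bound.
have G0 t : 0 <= G t by exact: excess_primitive_ge0.
have Gs t : t <= 0 -> G t = 0 by move=> t0; rewrite /G primitive_start// excess_primitive_eq0.
have Gc t t' : G t - G t' <= (y t - y t') * excess (y t) by exact: excess_primitive_convex.
clearbody G.
pose D : set (measurableTypeR R) := `]0%R, T[%classic.
have mD : measurable D by exact: measurable_itv.
have fD : (leb D < +oo)%E.
  by rewrite lebesgue_measure_itv /=; case: ifPn; rewrite -?EFinB ltry.
have mshift (f : R -> R) : measurable_fun setT f -> measurable_fun setT (fun t : R => f (t - rho)).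
  by move=> mf; exact: (measurableT_comp mf (measurable_shift rho)).
have bi (f : R -> R) B : measurable_fun setT f -> (forall t, `|f t| <= B) ->
    leb.-integrable D (EFin \o f).
  move=> mf fB; apply: measurable_bounded_integrable => //; first exact: measurable_funTS.
  by exists B; split; [exact: num_real|move=> z Bz t _; exact: le_trans (fB t) (ltW Bz)].
have iG := bi _ _ mG Gb.
have iGs : leb.-integrable D (EFin \o (fun t => G (t - rho))).
  by apply: (bi _ (C * M) (mshift _ mG)) => t; exact: Gb.
under eq_integral do rewrite primitive_increment.
apply: (@le_trans _ _ (\int[leb]_(t in D) ((G t)%:E - (G (t - rho))%:E))%E).
  have -> := integralB_EFin mD iG iGs.
  have Gfin := integrable_fin_num mD iG.
  rewrite sube_ge0; last by apply/orP; right; exact: Gfin.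
  rewrite !(integral_mkcond D).
  have mq : measurable_fun setT ((EFin \o G) \_ D).
    by apply/(measurable_restrictT _ mD); apply: measurable_funTS; exact/measurable_EFinP.
  have q0 t : (0 <= ((EFin \o G) \_ D) t)%E.
    by apply: erestrict_ge0 => s _; rewrite lee_fin.
  (* The telescoping is a comparison of shifted integrals on the whole line: for [t] in ]0, T[ the
     point [t - rho] either lies again in ]0, T[ or is nonpositive, where [G] is 0. The shifted
     integral therefore dominates. *)
  rewrite -[leRHS](ge0_integral_shift rho mq q0).
  apply: ge0_le_integral => //.
  - by move=> t _; apply: erestrict_ge0 => s _; rewrite lee_fin.
  - apply/(measurable_restrictT _ mD); apply: measurable_funTS; apply/measurable_EFinP.
    exact: mshift.
  - exact: (measurableT_comp mq (measurable_shift rho)).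
  - move=> t _; rewrite !patchE; case: ifPn => [|_]; last by case: ifPn; rewrite ?lee_fin.
    rewrite mem_setE in_itv /= => /andP[t0 tT].
    case: ifPn => //; rewrite in_itv /= (_ : t - rho < T) ?andbT; last first.
      by rewrite ltrBlDr (lt_trans tT)// ltrDl.
    by rewrite -leNgt => tr; rewrite Gs.
apply: le_integral => //.
- have := integrableB mD iG iGs.
  by congr (_.-integrable _ _); apply/funext => t /=.
- apply: (bi _ ((M + M) * C)).
    apply: measurable_funM; first exact: measurable_funB my (mshift _ my).
    by apply: measurableT_comp my; apply: continuous_measurable_fun; exact: excess_continuous.
  move=> t; rewrite normrM ler_pM//.
  by rewrite (le_trans (ler_normB _ _))// lerD// primitive_bound.
- by move=> t _; rewrite -EFinB lee_fin.
Qed.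

End primitive_energy.

Section sigma_finite_product.
Context d1 d2 (T1 : measurableType d1) (T2 : measurableType d2) (R : realType).
Variables (m1 : {sigma_finite_measure set T1 -> \bar R}).
Variables (m2 : {sigma_finite_measure set T2 -> \bar R}).

(* Packs [m1 \x m2] with its sigma-finiteness so that products can be iterated. *)
Definition sigma_finite_product : set (T1 * T2) -> \bar R := (m1 \x m2)%E.

HB.instance Definition _ := Measure.copy sigma_finite_product (m1 \x m2)%E.

Let sigma_finite_product_sigma_finite : sigma_finite setT sigma_finite_product.
Proof.
have /sigma_finiteP[F [TF ndF Foo]] := sigma_finiteT m1.
have /sigma_finiteP[G [TG ndG Goo]] := sigma_finiteT m2.
exists (fun k => F k `*` G k) => [|k].
  apply/esym/seteqP; split => // -[x y] _.
  have [k _ Fkx] : (\bigcup_k F k) x by rewrite -TF.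
  have [l _ Gly] : (\bigcup_k G k) y by rewrite -TG.
  exists (maxn k l) => //; split => /=.
  - by move: x Fkx; exact/subsetPset/ndF/leq_maxl.
  - by move: y Gly; exact/subsetPset/ndG/leq_maxr.
have [mF ?] := Foo k; have [mG ?] := Goo k.
split; first exact: measurableX.
by rewrite /sigma_finite_product product_measure1E// lte_mul_pinfty// ge0_fin_numE.
Qed.

HB.instance Definition _ := @Measure_isSigmaFinite.Build _ _ _
  sigma_finite_product sigma_finite_product_sigma_finite.

End sigma_finite_product.

(** * Nonnegativity of the energy integrated over space and time *)

Section caputo_energy.
Context dX (X : measurableType dX) (R : realType).
Variables (mu : {sigma_finite_measure set X -> \bar R}).
Variables (alpha T : R) (V : measurableTypeR R * X -> R) (U0 : X -> R).
Local Notation leb := (@lebesgue_measure R).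
Local Notation TX := (measurableTypeR R * X)%type.
Local Notation K := (caputo_kernel alpha).
Hypothesis halpha : 0 < alpha < 1.
Hypothesis mV : measurable_fun setT V.
Hypothesis iV : (leb \x mu)%E.-integrable setT (EFin \o V).
Hypothesis iVx : forall x, leb.-integrable setT (EFin \o (fun s => V (s, x))).
Hypothesis V0 : forall s x, s <= 0 -> V (s, x) = 0.
Hypothesis mU0 : measurable_fun setT U0.
Hypothesis U01 : forall x, `|U0 x| <= 1.

(** The jointly measurable substitute for [u], built from the velocity. Since [V] vanishes at
    nonpositive times, it equals [U0] there. *)
Definition primitive_in_time (p : TX) : R := U0 p.2 + \int[leb]_(s in `]-oo, p.1]) V (s, p.2).
(** The Caputo derivative without its factor [1/Gamma(1-alpha)]. *)
Definition caputo_integral (p : TX) : R := \int[leb]_s (K (p.1 - s) * V (s, p.2)).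
Local Notation U := primitive_in_time.
Local Notation L := caputo_integral.

Let inT (t : R) := (0 < t) && (t < T).
Local Notation nu := (sigma_finite_product leb mu).

Let mVs : measurable_fun setT (fun z : TX * measurableTypeR R => V (z.2, z.1.2)).
Proof.
apply: (measurableT_comp mV); apply: measurable_fun_pair => //.
exact: measurableT_comp.
Qed.

Let minT : measurable_fun setT (inT : measurableTypeR R -> bool).
Proof. by apply: measurable_and; apply: measurable_fun_ltr. Qed.

Let mK : measurable_fun setT (fun z : TX * measurableTypeR R => K (z.1.1 - z.2)).
Proof.
apply: measurableT_comp; first exact: measurable_caputo_kernel.
apply: measurable_funB => //.
exact: measurableT_comp.
Qed.

Let mL : measurable_fun setT L.
Proof. exact: (measurable_fun_Rintegral leb (measurable_funM mK mVs)). Qed.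

Let mU : measurable_fun setT U.
Proof.
apply: measurable_funD; first exact: measurableT_comp mU0 measurable_snd.
under eq_fun do rewrite Rintegral_mkcond.
pose f (z : TX * measurableTypeR R) : R := if z.2 <= z.1.1 then V (z.2, z.1.2) else 0.
have mf : measurable_fun setT f.
  apply: measurable_fun_ifT => //; apply: measurable_fun_ler => //.
  exact: measurableT_comp.
have := measurable_fun_Rintegral leb mf.
apply: eq_measurable_fun => t _; apply: eq_Rintegral => s _.
by rewrite patchE mem_setE in_itv /=; rewrite /f /=; case: ifPn.
Qed.

Let mexc : measurable_fun setT (fun p => excess (U p)).
Proof.
apply: measurableT_comp mU; apply: continuous_measurable_fun; exact: excess_continuous.
Qed.

Let F (z : TX * measurableTypeR R) : R :=
  if inT z.1.1 then V (z.2, z.1.2) * excess (U z.1) else 0.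

Let minT1 : measurable_fun setT (fun z : TX * measurableTypeR R => inT z.1.1).
Proof. by apply: (measurableT_comp minT); exact: measurableT_comp. Qed.

Let mF : measurable_fun setT F.
Proof.
apply: measurable_fun_ifT => //; apply: measurable_funM => //.
exact: measurableT_comp mexc measurable_fst.
Qed.

(** The L^1 convolution inequality: for each [s > 0] the integral over [t] of the kernel is at most
    its integral over ]0, T], which leaves the L^1 norm of [V]. All exchanges of integrals below
    rest on this absolute convergence. *)
Lemma caputo_kernel_V_integrable :
  (nu \x leb)%E.-integrable setT
    (EFin \o (fun z : TX * measurableTypeR R =>
      (if inT z.1.1 then K (z.1.1 - z.2) else 0) * V (z.2, z.1.2))).
Proof.
set Phi := (X in EFin \o X).
have mPhi : measurable_fun setT (EFin \o Phi).
  by apply/measurable_EFinP; apply: measurable_funM => //; exact: measurable_fun_ifT.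
apply: (@integrable21ltyP _ _ TX (measurableTypeR R) R nu leb _ mPhi).2.
set C := (\int[leb]_(r in `]0%R, T]) (K r)%:E)%E.
have Clty : (C < +oo)%E by exact: integral_caputo_kernel_lty.
have C0 : (0 <= C)%E by apply: integral_ge0 => r _; rewrite lee_fin caputo_kernel_ge0.
have mk s : measurable_fun setT (fun t : measurableTypeR R => if inT t then K (t - s) else 0).
  apply: measurable_fun_ifT => //.
  exact: (measurableT_comp (measurable_caputo_kernel alpha) (measurable_shift s)).
have hk s : 0 <= s -> (\int[leb]_t (if inT t then K (t - s) else 0)%:E <= C)%E.
  move=> s0.
  pose q : measurableTypeR R -> \bar R := (fun r => (K r)%:E) \_ `]0%R, T]%classic.
  have mq : measurable_fun setT q.
    apply/(measurable_restrictT _ (measurable_itv _)); apply: measurable_funTS.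
    by apply/measurable_EFinP; exact: measurable_caputo_kernel.
  have q0 r : (0 <= q r)%E.
    by apply: erestrict_ge0 => t _; rewrite lee_fin caputo_kernel_ge0.
  apply: (@le_trans _ _ (\int[leb]_t q (t - s)%R)%E); last first.
    by rewrite (ge0_integral_shift s mq q0) /C [leRHS]integral_mkcond.
  apply: ge0_le_integral => //.
  - by move=> t _; rewrite lee_fin; case: ifPn => // _; exact: caputo_kernel_ge0.
  - by apply/measurable_EFinP; exact: mk.
  - exact: (measurableT_comp mq (measurable_shift s)).
  - move=> t _; case: ifPn => [/andP[t0 tT]|_]; last exact: q0.
    rewrite /q patchE; case: ifPn => //; rewrite mem_setE in_itv /= negb_and -!leNgt -ltNge.
    move=> /orP[ts|]; last by rewrite ltNge lerBlDr (le_trans (ltW tT))// lerDl.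
    by rewrite /caputo_kernel ltNge ts.
have hV : (\int[leb]_s \int[mu]_x `|(V (s, x))%:E| < +oo)%E.
  have mVE : measurable_fun setT (EFin \o V) by exact/measurable_EFinP.
  exact: (@integrable12ltyP _ _ _ _ _ leb mu _ mVE).1.
pose v1 s := (\int[mu]_x `|(V (s, x))%:E|)%E.
have v1_ge0 s : (0 <= v1 s)%E by exact: integral_ge0.
have mv1 : measurable_fun setT v1.
  apply: (@measurable_fun_fubini_tonelli_F _ _ (measurableTypeR R) X R mu (fun z => `|(V z)%:E|%E)) => //.
  by apply: measurableT_comp => //; exact/measurable_EFinP.
apply: (@le_lt_trans _ _ (\int[leb]_s (C * v1 s))%E); last first.
  rewrite ge0_integralZl//.
  by rewrite lte_mul_pinfty// ge0_fin_numE.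
apply: ge0_le_integral => //.
- by move=> s _; exact: integral_ge0.
- apply: (@measurable_fun_fubini_tonelli_G _ _ TX (measurableTypeR R) R nu (fun z => `|(Phi z)%:E|%E)) => //.
  by apply: measurableT_comp.
- exact: emeasurable_funM.
move=> s _.
have mVx : measurable_fun setT (fun x => V (s, x)) by exact: (measurableT_comp mV).
have mPs : measurable_fun setT (fun p : TX => `|(Phi (p, s))%:E|%E).
  by apply: measurableT_comp => //; exact: (measurableT_comp mPhi).
have -> : (\int[nu]_p `|(EFin \o Phi) (p, s)| =
    \int[leb]_t ((if inT t then K (t - s) else 0)%:E * v1 s))%E.
  rewrite (@fubini_tonelli1 _ _ _ _ _ leb mu _ mPs)//.
  apply: eq_integral => t _; rewrite /fubini_F.
  have k0 : 0 <= (if inT t then K (t - s) else 0) by case: ifPn => // _; exact: caputo_kernel_ge0.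
  rewrite -ge0_integralZl_EFin//; last by apply: measurableT_comp => //; exact/measurable_EFinP.
  apply: eq_integral => x _; rewrite /Phi /= normrM (ger0_norm k0).
  by rewrite -EFinM.
rewrite ge0_integralZr//; last 2 first.
- exact/measurable_EFinP.
- by move=> t _; rewrite lee_fin; case: ifPn => // _; exact: caputo_kernel_ge0.
have [s0|s0] := ltP 0 s; first by rewrite lee_wpmul2r// hk// ltW.
suff -> : v1 s = 0%E by rewrite !mule0.
by rewrite /v1 integral0_eq// => x _; rewrite V0// abse0.
Qed.

Lemma caputo_energy_integrable :
  (leb \x mu)%E.-integrable setT
    (EFin \o (fun p : TX => if inT p.1 then L p * excess (U p) else 0)).
Proof.
have iPhi := caputo_kernel_V_integrable.
have mPhi := measurable_int _ iPhi.
have [C C0 hC] := excess_bound R.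
have Clty := (@integrable12ltyP _ _ TX (measurableTypeR R) R nu leb _ mPhi).1 iPhi.
apply/integrableP; split.
  apply/measurable_EFinP; apply: measurable_fun_ifT => //.
    exact: measurableT_comp minT measurable_fst.
  exact: measurable_funM.
set Phi := (fun z => _) in iPhi mPhi Clty.
apply: (@le_lt_trans _ _ (\int[nu]_p (C%:E * \int[leb]_s `|(EFin \o Phi) (p, s)|))%E); last first.
  rewrite ge0_integralZl//.
  - by rewrite lte_mul_pinfty.
  - apply: (@measurable_fun_fubini_tonelli_F _ _ TX (measurableTypeR R) R leb (fun z => `|(Phi z)%:E|%E)) => //.
    exact: measurableT_comp.
  - by move=> p _; exact: integral_ge0.
apply: ge0_le_integral => //.
- apply: measurableT_comp => //; apply/measurable_EFinP; apply: measurable_fun_ifT => //.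
    exact: measurableT_comp minT measurable_fst.
  exact: measurable_funM.
- apply: emeasurable_funM => //.
  apply: (@measurable_fun_fubini_tonelli_F _ _ TX (measurableTypeR R) R leb (fun z => `|(Phi z)%:E|%E)) => //.
  exact: measurableT_comp.
move=> p _ /=; have [pT|pT] := boolP (inT p.1); last first.
  by rewrite normr0 mule_ge0// integral_ge0.
rewrite normrM mulrC EFinM.
have -> : L p = fine (\int[leb]_s (EFin \o Phi) (p, s))%E.
  by rewrite /L /Rintegral; congr fine; apply: eq_integral => s _; rewrite /Phi /= pT.
apply: lee_pmul => //; first by rewrite lee_fin.
apply: (@le_trans _ _ `|\int[leb]_s (EFin \o Phi) (p, s)|%E).
  by case: (\int[leb]_s _)%E => [r||] /=; rewrite ?lexx ?leey.
apply: le_abse_integral => //; exact: (measurableT_comp mPhi).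
Qed.

Let iPsi : (nu \x leb)%E.-integrable setT
  (EFin \o (fun z : TX * measurableTypeR R => K (z.1.1 - z.2) * F z)).
Proof.
have [C C0 hC] := excess_bound R.
have := integrableZl measurableT C caputo_kernel_V_integrable.
apply: le_integrable => //.
  by apply/measurable_EFinP; exact: measurable_funM.
move=> [p s] _; rewrite /= lee_fin /F /=; case: ifPn => [pT|_]; last by rewrite mulr0 normr0.
rewrite mulrA mulrC !normrM ler_pM//.
by rewrite (le_trans (hC _))// ler_norm.
Qed.

(** At level [h] the kernel is the indicator of [t - rho < s < t] with [rho = h^(-1/alpha)].
    Integrating in [s], then [t], and in [x] last, leaves at each [x] the energy of
    [primitive_energy_ge0]. *)
Let integral_level h : 0 < h ->
  (nu \x leb)%E.-integrable setT
    (EFin \o (fun z : TX * measurableTypeR R => if h < K (z.1.1 - z.2) then F z else 0)) ->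
  (0 <= \int[(nu \x leb)%E]_z (if h < K (z.1.1 - z.2) then F z else 0)%:E)%E.
Proof.
move=> h0 ih.
have := @integral12_prod_meas1 _ _ TX (measurableTypeR R) R nu leb _ ih => /= <-.
have ihF := @integrable_fubini_F _ _ TX (measurableTypeR R) R nu leb _ ih.
have := @integral21_prod_meas1 _ _ (measurableTypeR R) X R leb mu _ ihF.
rewrite /sigma_finite_product => <-.
apply: integral_ge0 => x _; rewrite /fubini_G.
have rho0 := powR_gt0 (- alpha^-1) h0; set rho := h `^ (- alpha^-1) in rho0.
have := @primitive_energy_ge0 R (fun s => V (s, x)) (U0 x) T rho (iVx x)
  (fun s => @V0 s x) (U01 x) rho0.
rewrite [X in (0 <= X)%E -> _]integral_mkcond.
congr (0 <= _)%E; apply: eq_integral => t _.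
rewrite patchE mem_setE in_itv /= -/(inT t) /fubini_F /=.
case: ifPn => tT; last first.
  by rewrite integral0_eq// => s _; rewrite /F /= (negbTE tT) if_same.
have mI : measurable (`]t - rho, t[%classic : set (measurableTypeR R)) by exact: measurable_itv.
have iI : leb.-integrable `]t - rho, t[ (EFin \o (fun s => V (s, x))).
  by apply: integrableS (iVx x) => //; exact: measurable_itv.
rewrite -RintegralZr//.
rewrite /Rintegral fineK; last first.
  apply: (integrable_fin_num mI).
  have := integrableZl mI (excess (U (t, x))) iI.
  by congr (_.-integrable _ _); apply/funext => s /=; rewrite muleC -EFinM.
rewrite integral_mkcond; apply: eq_integral => s _.
rewrite patchE mem_setE in_itv /= /F /= tT caputo_kernel_level// subr_gt0.
by rewrite ltrBlDr -ltrBlDl andbC; case: ifPn.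
Qed.

Lemma caputo_energy_ge0 :
  (0 <= \int[(leb \x mu)%E]_p (if inT p.1 then L p * excess (U p) else 0)%:E)%E.
Proof.
have <- : (\int[(nu \x leb)%E]_z (K (z.1.1 - z.2) * F z)%:E =
    \int[(leb \x mu)%E]_p (if inT p.1 then L p * excess (U p) else 0)%:E)%E.
  have := @integral12_prod_meas1 _ _ TX (measurableTypeR R) R nu leb _ iPsi => /= <-.
  have iPhi := caputo_kernel_V_integrable.
  apply: ae_eq_integral => //.
  - exact: (@measurable_fubini_F _ _ TX (measurableTypeR R) R nu leb _ iPsi).
  - exact: measurable_int caputo_energy_integrable.
  (* The factor [excess (U p)] enters the real-valued integral [L p] where the section in [s] is
     integrable, that is, for almost every [p] with time in ]0, T[. *)
  have := @ae_integrable1 _ _ TX (measurableTypeR R) R nu leb _ iPhi.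
  apply: filterS => p ip _; rewrite /fubini_F /=.
  case: ifPn => pT; last first.
    by rewrite integral0_eq// => s _; rewrite /F /= (negbTE pT) mulr0.
  have iL : leb.-integrable setT (EFin \o (fun s => K (p.1 - s) * V (s, p.2))).
    by move: ip; congr (_.-integrable _ _); apply/funext => s /=; rewrite pT.
  rewrite /L -RintegralZr// /Rintegral fineK; last first.
    apply: integrable_fin_num => //.
    have := integrableZl measurableT (excess (U p)) iL.
    by congr (_.-integrable _ _); apply/funext => s /=; rewrite muleC -EFinM.
  by apply: eq_integral => s _; rewrite /F /= pT mulrA.
apply: (@layer_cake_ge0 _ (TX * measurableTypeR R)%type R (sigma_finite_product nu leb)
  (fun z => K (z.1.1 - z.2)) F) => //.
by move=> z; exact: caputo_kernel_ge0.
Qed.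

End caputo_energy.

Section ae_sign.
Context d (S : measurableType d) (R : realType) (mu : {measure set S -> \bar R}).
Variables (D : set S) (f : S -> \bar R).
Hypothesis mD : measurable D.
Hypothesis If : mu.-integrable D f.
Hypothesis f_le0 : {ae mu, forall x, D x -> (f x <= 0)%E}.

Let f_abs : (\int[mu]_(x in D) `|f x| = - \int[mu]_(x in D) f x)%E.
Proof.
have mf := measurable_int _ If.
rewrite -integralN; last exact: integrable_add_def.
apply: ae_eq_integral => //.
- exact: measurableT_comp.
- exact: measurableT_comp.
by apply: filterS f_le0 => x fx Dx; rewrite lee0_abs ?fx.
Qed.

Lemma ae_le0_integral_le0 : (\int[mu]_(x in D) f x <= 0)%E.
Proof. by rewrite -oppe_ge0 -f_abs integral_ge0. Qed.

Lemma ae_le0_integral_ge0 : (0 <= \int[mu]_(x in D) f x)%E ->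
  {ae mu, forall x, D x -> f x = 0%E}.
Proof.
move=> h.
have f0 : (\int[mu]_(x in D) `|f x| = 0)%E.
  by apply/eqP; rewrite eq_le integral_ge0// andbT f_abs oppe_le0.
exact: (ae_eq_integral_abs mu mD (measurable_int _ If)).1 f0.
Qed.

End ae_sign.

Section pointwise.
Variables (R : realType) (d : nat) (Omega : set 'rV[R]_d).
Local Notation E := 'rV[R]_d.
Local Notation mu := (lebesgue_row d).

(** A violation at a continuity point spreads to a nonempty open subset of the exceptional null set,
    which has positive measure. *)
Lemma ae_le1_continuous (f : E -> R) x : open Omega ->
  {ae mu, forall x, Omega x -> `|f x| <= 1} ->
  Omega x -> {for x, continuous f} -> `|f x| <= 1.
Proof.
move=> oO [N [mN N0 subN]] Ox cf; rewrite leNgt; apply/negP => fx.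
pose A := (Omega `&` [set y | 1 < `|f y|])^°.
have Ax : A x.
  apply: filterI; first exact: oO.
  have /cvg_norm cn := cf.
  exact: (cvgr_gt _ cn).
have oA : open A by exact: open_interior.
have AN : A `<=` N.
  move=> y /interior_subset[Oy fy]; apply: subN => /= /(_ Oy).
  by rewrite leNgt fy.
have := lebesgue_row_open_gt0 oA (ex_intro _ x Ax).
rewrite ltNge -[X in (_ <= X)%E]N0 le_measure ?inE//.
exact: open_measurable_row.
Qed.

End pointwise.

(** * From the equation to the bound *)

Section reaction.
Variables (R : realType) (d : nat) (Omega : set 'rV[R]_d).
Local Notation E := 'rV[R]_d.
Local Notation mu := (lebesgue_row d).
Hypothesis mO : measurable Omega.
Hypothesis fO : (mu Omega < +oo)%E.

Variables (f w : E -> R) (kappa : R).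
Hypothesis H2f : H2 Omega f.
Hypothesis H10f : H10 Omega f.
Hypothesis lw : L2 Omega w.
Hypothesis fw : {ae mu, forall x, Omega x ->
  w x - kappa ^+ 2 * weak_laplacian Omega f x = f x - f x ^+ 3}.

Let lf : L2 Omega f. Proof. by case: H2f => -[]. Qed.
Let lef : L2 Omega (excess \o f).
Proof. have mf := L2_measurable mO lf. exact: (L2_excess mO fO mf). Qed.
Let lD := L2_weak_laplacian mO fO H2f.

(** The tested equation, represented by its left-hand side: integrability follows from [w] and the
    Laplacian being in L^2, and the sign from the almost everywhere equality with the cubic side. *)
Let q x := w x * excess (f x) - kappa ^+ 2 * (weak_laplacian Omega f x * excess (f x)).

Let iw : mu.-integrable Omega (EFin \o (fun x => w x * excess (f x))).
Proof. exact (L2_mul_integrable mO lw lef). Qed.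

Let iD : mu.-integrable Omega
  (EFin \o (fun x => kappa ^+ 2 * (weak_laplacian Omega f x * excess (f x)))).
Proof.
have := integrableZl mO (kappa ^+ 2) (L2_mul_integrable mO lD lef).
by congr (_.-integrable _ _); apply/funext => x /=; rewrite EFinM.
Qed.

Let iq : mu.-integrable Omega (EFin \o q).
Proof.
have := integrableB mO iw iD.
by congr (_.-integrable _ _); apply/funext => x /=; rewrite EFinB.
Qed.

Let qE : {ae mu, forall x, Omega x -> q x = (f x - f x ^+ 3) * excess (f x)}.
Proof. by apply: filterS fw => x wx Ox; rewrite -(wx Ox) /q mulrBl mulrA. Qed.

Let q_le0 : {ae mu, forall x, Omega x -> ((EFin \o q) x <= 0)%E}.
Proof. by apply: filterS qE => x qx Ox; rewrite lee_fin (qx Ox) excess_cubic_le0. Qed.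

Let energy_le : \int[mu]_(x in Omega) (w x * excess (f x)) <= \int[mu]_(x in Omega) q x.
Proof.
rewrite RintegralB// lerBrDr gerDl RintegralZl//; last exact (L2_mul_integrable mO lD lef).
by rewrite mulr_ge0_le0 ?sqr_ge0//; exact: weak_laplacian_excess_le0.
Qed.

Lemma reaction_energy_le0 : \int[mu]_(x in Omega) (w x * excess (f x)) <= 0.
Proof.
apply: le_trans energy_le _; rewrite -lee_fin /Rintegral fineK.
  exact (ae_le0_integral_le0 mO iq q_le0).
exact (integrable_fin_num mO iq).
Qed.

Lemma reaction_energy_eq0 : \int[mu]_(x in Omega) (w x * excess (f x)) = 0 ->
  {ae mu, forall x, Omega x -> `|f x| <= 1}.
Proof.
move=> w0; have q0 : (0 <= \int[mu]_(x in Omega) (q x)%:E)%E.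
  have := energy_le; rewrite w0 -lee_fin /Rintegral fineK//.
  exact (integrable_fin_num mO iq).
have := ae_le0_integral_ge0 mO iq q_le0 q0.
have := qE; apply: filterS2 => x qx q0x Ox.
rewrite leNgt; apply/negP => /excess_cubic_lt0.
by have [qx0] := q0x Ox; rewrite -(qx Ox) qx0 ltxx.
Qed.

End reaction.

(** * Integrability of the velocity in space and time *)

Section velocity.
Variables (R : realType) (d : nat) (Omega : set 'rV[R]_d) (T : R).
Variable (v : R -> 'rV[R]_d -> R).
Local Notation E := 'rV[R]_d.
Local Notation mu := (lebesgue_row d).
Local Notation leb := (@lebesgue_measure R).
Local Notation TE := (measurableTypeR R * E)%type.
Hypothesis mO : measurable Omega.
Hypothesis fO : (mu Omega < +oo)%E.
Hypothesis mv : measurable_fun (`[0, T] `*` Omega : set TE) (fun p => v p.1 p.2).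
Hypothesis lv : (\int[leb]_(t in `[0%R, T]) L2norm Omega (v t) < +oo)%E.

(** Time 0 is cut off as well, so that the velocity vanishes at all nonpositive times; this changes
    no integral. *)
Definition velocity_cut : TE -> R :=
  (fun p => v p.1 p.2) \_ (`]0, T] `*` Omega : set TE).

Lemma velocity_cutE s x : velocity_cut (s, x) =
  if (0 < s <= T) && (x \in Omega) then v s x else 0.
Proof.
rewrite /velocity_cut patchE; congr (if _ then _ else _).
apply/idP/idP => [|/andP[sT xO]]; rewrite !inE /= in_itv /=.
  by move=> [-> xO] /=; rewrite inE.
by split => //; move: xO; rewrite inE.
Qed.

Lemma measurable_velocity_cut : measurable_fun setT velocity_cut.
Proof.
have mI a : measurable ([set` Interval (BSide a 0) (BRight T)] `*` Omega : set TE).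
  by apply: measurableX => //; exact: measurable_itv.
apply/(measurable_restrictT _ (mI false)).
apply: (measurable_funS (mI true)) mv.
by move=> [s x] [/= + xO]; rewrite in_itv /= => /andP[s0 sT];
    split => //=; rewrite in_itv /= (ltW s0).
Qed.

(** Cauchy-Schwarz against the constant 1 bounds the space integral at time [s] by the norm of 1 on
    [Omega] times the L^2 norm of the velocity, which is integrable in time. *)
Lemma velocity_cut_integrable : (leb \x mu)%E.-integrable setT (EFin \o velocity_cut).
Proof.
have mV := measurable_velocity_cut.
have mVE : measurable_fun setT (EFin \o velocity_cut) by exact/measurable_EFinP.
apply: (@integrable12ltyP _ _ (measurableTypeR R) E R leb mu _ mVE).2.
have mVs s : measurable_fun setT (fun x => velocity_cut (s, x)).
  exact: (measurableT_comp mV (pair1_measurable s)).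
(* Tonelli makes this norm of the jointly measurable cut measurable in [s]; the norm of [v s]
   inherits it on ]0, T]. *)
pose N s : \bar R := 'N[mu]_2%:E [EFin \o (fun x => velocity_cut (s, x))]%E.
have mN : measurable_fun setT N.
  rewrite /N unlock; apply: (measurableT_comp (measurable_poweR _)).
  apply: (@measurable_fun_fubini_tonelli_F _ _ (measurableTypeR R) E R mu
    (fun z => (`|(velocity_cut z)%:E| `^ 2)%E)); last by move=> z; exact: poweR_ge0.
  apply: (measurableT_comp (measurable_poweR _)); exact: measurableT_comp.
have NE (s : R) : s \in `]0, T] -> N s = L2norm Omega (v s).
  rewrite in_itv /= => sT; apply: eq_Lnorm => x /=; rewrite velocity_cutE sT patchE /=.
  by case: ifPn.
have N0 (s : R) : s \notin `]0, T] -> N s = 0%E.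
  rewrite in_itv /= => /negbTE sT; rewrite -(@Lnorm0 _ E R mu 2%:E)//.
  by apply: eq_Lnorm => x /=; rewrite velocity_cutE sT.
have iN : (\int[leb]_s N s < +oo)%E.
  have mL : measurable_fun `]0, T]%classic (fun t => L2norm Omega (v t)).
    apply: (eq_measurable_fun N); last exact: measurable_funTS.
    by move=> s; rewrite inE /= => sT; rewrite NE.
  move: lv; rewrite -(integral_itv_obnd_cbnd mL); congr (_ < _)%E.
  rewrite integral_mkcond; apply: eq_integral => s _; rewrite patchE mem_setE.
  by case: ifPn => sT; [rewrite NE|rewrite N0].
have l1 : L2 Omega (cst 1) by apply: (@L2_bounded _ _ _ mO fO _ 1) => // x _; rewrite normr1.
pose c : \bar R := L2norm Omega (cst 1).
have cfin : c \is a fin_num.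
  rewrite ge0_fin_numE ?Lnorm_ge0//.
  by move: l1; rewrite /L2 inE => /andP[_]; rewrite inE.
apply: (@le_lt_trans _ _ (\int[leb]_s (c * N s))%E); last first.
  rewrite ge0_integralZl//; first by rewrite lte_mul_pinfty// Lnorm_ge0.
  - by move=> s _; exact: Lnorm_ge0.
  - exact: Lnorm_ge0.
apply: ge0_le_integral => //.
- by move=> s _; exact: integral_ge0.
- apply: (@measurable_fun_fubini_tonelli_F _ _ (measurableTypeR R) E R mu
    (fun z => `|(velocity_cut z)%:E|%E)) => //.
  exact: measurableT_comp.
- exact: emeasurable_funM.
move=> s _.
have m1 : measurable_fun setT ((cst (1 : R) : E -> R) \_ Omega).
  by apply/(measurable_restrictT _ mO).
have := hoelder mu m1 (mVs s) (ltr0Sn R 1) (ltr0Sn R 1).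
have -> : (2^-1 + 2^-1 : R) = 1 by rewrite [RHS]splitr div1r.
move=> /(_ erefl); rewrite Lnorm1; apply: le_trans.
rewrite le_eqVlt; apply/orP; left; apply/eqP; apply: eq_integral => x _ /=.
rewrite velocity_cutE patchE; case: (x \in Omega); first by rewrite mul1r.
by rewrite andbF mulr0.
Qed.

End velocity.

(** * The bound at almost every time *)

Section almost_every_time.
Variables (R : realType) (d : nat) (alpha kappa T : R) (Omega : set 'rV[R]_d).
Local Notation E := 'rV[R]_d.
Local Notation mu := (lebesgue_row d).
Local Notation leb := (@lebesgue_measure R).
Local Notation TE := (measurableTypeR R * E)%type.
Variables (u0 : E -> R) (u v w : R -> E -> R).
Hypothesis halpha : 0 < alpha < 1.
Hypothesis T0 : 0 < T.
Hypothesis mO : measurable Omega.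
Hypothesis fO : (mu Omega < +oo)%E.
Hypothesis hu0 : forall x, Omega x -> `|u0 x| <= 1.
Hypothesis hH2 : forall t, t \in `[0, T] -> H2 Omega (u t) /\ H10 Omega (u t).
Hypothesis hv : time_derivative Omega T u v.
Hypothesis hw : {ae leb, forall t, t \in `]0, T[ -> {ae mu, forall x, Omega x ->
  w t x = caputo_formula alpha v t x}}.
Hypothesis lw : forall t, t \in `[0, T] -> L2 Omega (w t).
Hypothesis pde : forall t, t \in `]0, T[ -> {ae mu, forall x, Omega x ->
  w t x - kappa ^+ 2 * weak_laplacian Omega (u t) x = u t x - u t x ^+ 3}.
Hypothesis hinit : {ae mu, forall x, Omega x -> u 0 x = u0 x}.

Let L2u t : t \in `[0, T] -> L2 Omega (u t).
Proof. by move=> /hH2[[[]]]. Qed.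

Let Vc := velocity_cut Omega T v.

Let mVc : measurable_fun setT Vc.
Proof. by case: hv => mv _ _; exact: measurable_velocity_cut. Qed.

Let iVc : (leb \x mu)%E.-integrable setT (EFin \o Vc).
Proof. by case: hv => mv lv _; exact: velocity_cut_integrable. Qed.

Section off_null_set.
Variable N : set E.
Hypothesis mN : measurable N.
Hypothesis N0 : mu N = 0%E.
Hypothesis iVN : forall x, ~ N x -> leb.-integrable setT (fun s => (Vc (s, x))%:E).

(* The velocity is discarded on the null set of points where it is not integrable in time. *)
Let V (p : TE) : R := if p.2 \in N then 0 else Vc p.

Let mV : measurable_fun setT V.
Proof.
apply: measurable_fun_ifT => //.
apply: (@measurable_fun_bool _ _ _ _ true).
rewrite setTI (_ : _ @^-1` _ = snd @^-1` N); last first.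
  by apply/seteqP; split => -[s x] /=; [move=> /set_mem|move=> /mem_set].
by rewrite -[X in measurable X]setTI; exact: measurable_snd.
Qed.

Let iV : (leb \x mu)%E.-integrable setT (EFin \o V).
Proof.
apply: le_integrable iVc => //; first by apply/measurable_EFinP; exact: mV.
by move=> p _; rewrite /= /V; case: ifPn => // _; rewrite normr0 lee_fin.
Qed.

Let iVx x : leb.-integrable setT (EFin \o (fun s => V (s, x))).
Proof.
rewrite /V /=; have [xN|xN] := boolP (x \in N).
  by rewrite (_ : _ \o _ = cst 0%E)//; exact: integrable0.
by apply: iVN; move: xN; rewrite notin_setE.
Qed.

Let V0 s x : s <= 0 -> V (s, x) = 0.
Proof.
by move=> s0; rewrite /V /= /Vc velocity_cutE ltNge s0; case: ifP.
Qed.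

Let VE s x : Omega x -> ~ N x -> 0 < s <= T -> V (s, x) = v s x.
Proof.
move=> Ox Nx sT; rewrite /V /= (_ : (x \in N) = false); last first.
  by apply/negbTE; rewrite notin_setE.
by rewrite /Vc velocity_cutE sT mem_set.
Qed.

(** The one-dimensional energy estimate wants an initial value bounded by 1 at every point, whereas
    [u 0] is so only almost everywhere on [Omega]. The truncation changes it there on a null set. *)
Let U0 (x : E) : R := if `|(u 0 \_ Omega) x| <= 1 then (u 0 \_ Omega) x else 0.

Let mU0 : measurable_fun setT U0.
Proof.
have mu0 : measurable_fun setT (u 0 \_ Omega).
  have l0 : L2 Omega (u 0) by apply: L2u; rewrite in_itv /= lexx ltW.
  have m0 := L2_measurable mO l0.
  exact/(measurable_restrictT _ mO).
apply: measurable_fun_ifT => //; apply: measurable_fun_ler => //.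
exact: measurableT_comp.
Qed.

Let U01 x : `|U0 x| <= 1.
Proof. by rewrite /U0; case: ifPn => // _; rewrite normr0. Qed.

Let U := primitive_in_time V U0.
Let L := caputo_integral alpha V.

Let LE t x : Omega x -> ~ N x -> 0 < t < T ->
  L (t, x) = \int[leb]_(s in `[0, t]) ((t - s) `^ (- alpha) * v s x).
Proof.
move=> Ox Nx /andP[t0 tT].
have /andP[a0 _] := halpha.
have E1 s : 0 < s <= t ->
    caputo_kernel alpha (t - s) * V (s, x) = (t - s) `^ (- alpha) * v s x.
  move=> /andP[s0 st]; rewrite VE ?s0 ?(le_trans st (ltW tT))//.
  rewrite /caputo_kernel subr_gt0; case: ifPn => //; rewrite -leNgt => ts.
  (* At [s = t] both sides are 0, because [powR] sends 0 to 0 for a nonzero exponent. *)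
  by rewrite (@le_anti _ _ s t) ?st ?ts// subrr powR0// oppr_eq0 gt_eqF.
have mK : measurable_fun setT
    (fun s : measurableTypeR R => caputo_kernel alpha (t - s) * V (s, x)).
  apply: measurable_funM; last exact: (measurableT_comp mV (pair2_measurable x)).
  apply: measurableT_comp; first exact: measurable_caputo_kernel.
  exact: measurable_funB.
rewrite /L /caputo_integral /Rintegral /=; congr fine.
rewrite -integral_itv_obnd_cbnd; last first.
  apply/measurable_EFinP; apply: (eq_measurable_fun _ _ (measurable_funTS mK)).
  by move=> s; rewrite inE /= in_itv /= => /E1.
rewrite [RHS]integral_mkcond; apply: eq_integral => s _.
rewrite patchE mem_setE in_itv /=; case: ifPn => [/E1->//|].
rewrite negb_and -leNgt -ltNge => /orP[s0|ts]; first by rewrite V0// mulr0.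
by rewrite /caputo_kernel subr_gt0 ltNge (ltW ts) /= mul0r.
Qed.

Let UE t x : Omega x -> ~ N x -> 0 < t < T -> `|u 0 x| <= 1 ->
  U (t, x) = u 0 x + \int[leb]_(s in `[0, t]) v s x.
Proof.
move=> Ox Nx /andP[t0 tT] u01.
have E1 s : 0 < s <= t -> V (s, x) = v s x.
  by move=> /andP[s0 st]; rewrite VE ?s0 ?(le_trans st (ltW tT)).
rewrite /U /primitive_in_time /= /U0 patchE mem_set// u01; congr (_ + _).
rewrite /Rintegral; congr fine.
rewrite -integral_itv_obnd_cbnd; last first.
  apply/measurable_EFinP; apply: (eq_measurable_fun (fun s => V (s, x))).
    by move=> s; rewrite inE /= in_itv /= => /E1.
  by apply: measurable_funTS; exact: (measurableT_comp mV (pair2_measurable x)).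
rewrite [LHS]integral_mkcond [RHS]integral_mkcond; apply: eq_integral => s _.
rewrite !patchE !mem_setE !in_itv /=; have [st|st] := leP s t; last by rewrite andbF.
rewrite andbT; have [s0|s0] := ltP 0 s; last by rewrite V0.
by rewrite E1// s0.
Qed.

Let h (p : TE) : R := if (0 < p.1) && (p.1 < T) then L p * excess (U p) else 0.

Let ih : (leb \x mu)%E.-integrable setT (EFin \o h).
Proof. exact: caputo_energy_integrable. Qed.

Let h_ge0 : (0 <= \int[(leb \x mu)%E]_p (h p)%:E)%E.
Proof. exact: caputo_energy_ge0. Qed.

Let c := (Gamma (1 - alpha))^-1.

Let c_ge0 : 0 <= c.
Proof.
by rewrite invr_ge0; apply: Rintegral_ge0 => t _; rewrite mulr_ge0 ?powR_ge0 ?expR_ge0.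
Qed.

Let H (t : measurableTypeR R) : \bar R := (\int[mu]_x (h (t, x))%:E)%E.

Let J t := \int[mu]_(x in Omega) (w t x * excess (u t x)).

(** The passage from the substitutes back to the solution: at almost every [t], outside a null set
    of [x] that depends on [t], [w t] is [c L(t, x)] and [u t] is [U(t, x)]. Off [Omega] the
    velocity is 0, hence so is [h]. *)
Let HJ : {ae leb, forall t, t \in `]0, T[ -> (c%:E * H t = (J t)%:E)%E}.
Proof.
have := @ae_integrable1 _ _ (measurableTypeR R) E R leb mu _ ih.
move: hw; apply: (@filterS2 _ _ (ae_filter_ringOfSetsType leb)) => t wt iht tT.
have t0T : t \in `[0, T] by move: tT; rewrite !in_itv /= => /andP[/ltW-> /ltW->].
have lu := L2u t0T.
have lex : L2 Omega (excess \o u t) by exact (L2_excess mO fO (L2_measurable mO lu)).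
have iJ := L2_mul_integrable mO (lw t0T) lex.
have JE : ((J t)%:E = \int[mu]_(x in Omega) (w t x * excess (u t x))%:E)%E.
  by rewrite /J /Rintegral fineK//; exact (integrable_fin_num mO iJ).
rewrite JE /H -(integralZl measurableT iht) [RHS](integral_mkcond Omega).
apply: (@ae_eq_integral _ _ R mu setT) => //.
- exact (measurable_int _ (integrableZl measurableT c iht)).
- by apply/(measurable_restrictT _ mO); exact (measurable_int _ iJ).
have [_ _ /(_ t t0T) ut] := hv.
have hN : {ae mu, forall x, ~ N x}.
  by exists N; split => // x /= /contrapT.
have h1 := @filterI _ _ (ae_filter_ringOfSetsType mu) _ _ hN hinit.
have h2 := @filterI _ _ (ae_filter_ringOfSetsType mu) _ _ (wt tT) ut.
move: h1 h2. apply: (@filterS2 _ _ (ae_filter_ringOfSetsType mu)) => x [Nx initx] [wx ux] _.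
move: tT; rewrite in_itv /= => tT.
rewrite patchE; case: ifPn => [|xO]; last first.
  suff -> : h (t, x) = 0 by rewrite mule0.
  rewrite /h /= tT /L /caputo_integral /Rintegral integral0_eq ?mul0r// => s _ /=.
  rewrite /V /Vc velocity_cutE (negbTE xO) andbF; by case: ifP; rewrite mulr0.
rewrite inE => Ox; rewrite -EFinM /h /= tT; congr EFin.
have u01 : `|u 0 x| <= 1 by rewrite initx// hu0.
by rewrite (LE Ox Nx tT) (UE Ox Nx tT u01) -(ux Ox) (wx Ox) mulrA.
Qed.

Lemma almost_every_time_off_null_set :
  {ae leb, forall t, t \in `]0, T[ -> {ae mu, forall x, Omega x -> `|u t x| <= 1}}.
Proof.
have iH : leb.-integrable setT H.
  exact: (@integrable_fubini_F _ _ (measurableTypeR R) E R leb mu _ ih).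
have icH := integrableZl measurableT c iH.
have react t : t \in `]0, T[ ->
    J t <= 0 /\ (J t = 0 -> {ae mu, forall x, Omega x -> `|u t x| <= 1}).
  move=> tT.
  have t0T : t \in `[0, T] by move: tT; rewrite !in_itv /= => /andP[/ltW-> /ltW->].
  have [h2 h10] := hH2 t0T; split.
    exact (reaction_energy_le0 mO fO h2 h10 (lw t0T) (pde tT)).
  exact (reaction_energy_eq0 mO fO h2 h10 (lw t0T) (pde tT)).
have cH_le0 : {ae leb, forall t, [set: measurableTypeR R] t -> (c%:E * H t <= 0)%E}.
  move: HJ; apply: (@filterS _ _ (ae_filter_ringOfSetsType leb)) => t ht _.
  have [tT|tT] := boolP (t \in `]0, T[).
    by rewrite ht// lee_fin; have [] := react t tT.
  rewrite /H integral0_eq ?mule0// => x _; rewrite /h /= ifF//.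
  by apply/negbTE; move: tT; rewrite in_itv.
have cH_int : (0 <= \int[leb]_t (c%:E * H t))%E.
  rewrite integralZl// mule_ge0// ?lee_fin//.
  have := @integral12_prod_meas1 _ _ (measurableTypeR R) E R leb mu _ ih.
  by rewrite /fubini_F /H => ->.
have := ae_le0_integral_ge0 measurableT icH cH_le0 cH_int.
move: HJ; apply: (@filterS2 _ _ (ae_filter_ringOfSetsType leb)) => t ht cH0 tT.
have [_] := react t tT; apply.
by have := ht tT; rewrite cH0// => -[].
Qed.

End off_null_set.

Lemma almost_every_time_le1 :
  {ae leb, forall t, t \in `]0, T[ -> {ae mu, forall x, Omega x -> `|u t x| <= 1}}.
Proof.
have [N [mN N0 subN]] := @ae_integrable2 _ _ (measurableTypeR R) E R leb mu _ iVc.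
apply: (almost_every_time_off_null_set mN N0) => x Nx.
by apply: contra_notP Nx => ?; exact: subN.
Qed.

End almost_every_time.

(** * Passage from almost every time to every time *)

Section L2_closed.
Variables (R : realType) (d : nat) (Omega : set 'rV[R]_d).
Local Notation E := 'rV[R]_d.
Local Notation mu := (lebesgue_row d).
Hypothesis mO : measurable Omega.
Hypothesis fO : (mu Omega < +oo)%E.

(** As [excess] is Lipschitz and vanishes on the values of [g], the integral of [excess(f)^2] is at
    most [K^2 |g - f|^2] in L^2 norm, hence 0. No almost everywhere convergent subsequence is
    extracted. *)
Lemma ae_le1_L2_closed (f : E -> R) : L2 Omega f ->
  (forall e : R, 0 < e -> exists g, [/\ L2 Omega g,
     {ae mu, forall x, Omega x -> `|g x| <= 1} &
     (L2norm Omega (g \- f)%R < e%:E)%E]) ->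
  {ae mu, forall x, Omega x -> `|f x| <= 1}.
Proof.
move=> lf approx.
have [K K0 hK] := excess_lipschitz R.
have lef : L2 Omega (excess \o f) by exact (L2_excess mO fO (L2_measurable mO lf)).
have ief := L2_sqr_integrable mO lef.
pose r := \int[mu]_(x in Omega) (excess (f x) ^+ 2).
have rE : (\int[mu]_(x in Omega) (excess (f x) ^+ 2)%:E = r%:E)%E.
  by rewrite /r /Rintegral fineK//; exact (integrable_fin_num mO ief).
have rle e : 0 < e -> r <= K ^+ 2 * e ^+ 2.
  move=> e0; have [g [lg g1 ge]] := approx e e0.
  have lgf := L2B lg lf.
  have igf := L2_sqr_integrable mO lgf.
  apply: (@le_trans _ _ (K ^+ 2 * \int[mu]_(x in Omega) ((g x - f x) ^+ 2))); last first.
    by rewrite ler_wpM2l ?sqr_ge0//; exact (L2norm_lt mO lgf (ltW e0) ge).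
  rewrite -RintegralZl// -lee_fin -rE /Rintegral fineK; last first.
    by have /(integrable_fin_num mO) := integrableZl mO (K ^+ 2) igf.
  apply: ae_ge0_le_integral => //.
  - by move=> x _; rewrite lee_fin sqr_ge0.
  - exact (measurable_int _ ief).
  - by move=> x _; rewrite lee_fin mulr_ge0 ?sqr_ge0.
  - exact (measurable_int _ (integrableZl mO (K ^+ 2) igf)).
  apply: filterS g1 => x gx Ox; rewrite lee_fin -exprMn.
  rewrite -[leLHS]real_normK ?num_real// -[leRHS]real_normK ?num_real//.
  rewrite lerXn2r ?nnegrE// normrM (ger0_norm K0) -normrN.
  by have := hK (g x) (f x); rewrite (excess_eq0 (gx Ox)) sub0r.
have r0 : r <= 0.
  apply/ler_addgt0Pl => e e0; rewrite addr0.
  have s0 : 0 < e / (K ^+ 2 + 1) by rewrite divr_gt0// ltr_wpDl ?sqr_ge0.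
  (* This distance makes the bound [K^2 e/(K^2 + 1) <= e]; the added 1 covers [K = 0]. *)
  have := rle (Num.sqrt (e / (K ^+ 2 + 1))).
  rewrite sqrtr_gt0 s0 => /(_ isT) /le_trans; apply.
  rewrite sqr_sqrtr ?(ltW s0)// mulrCA ler_piMr ?(ltW e0)//.
  by rewrite ler_pdivrMr ?mul1r ?lerDl// ltr_wpDl ?sqr_ge0.
have : ae_eq mu Omega (fun x => (excess (f x) ^+ 2)%:E) (cst 0%E).
  apply/(ae_eq_integral_abs mu mO (measurable_int _ ief)).
  apply/eqP; rewrite eq_le integral_ge0// andbT.
  rewrite (eq_integral (fun x => (excess (f x) ^+ 2)%:E)) ?rE ?lee_fin//.
  by move=> x _; rewrite /= ger0_norm ?sqr_ge0.
apply: filterS => x /[swap] Ox /(_ Ox) [] /eqP; rewrite sqrf_eq0 => /eqP ex0.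
by rewrite leNgt; apply/negP => /excess_cubic_lt0; rewrite ex0 mulr0 ltxx.
Qed.

End L2_closed.

(** A set of full measure meets every nondegenerate interval, here []max(a, t - e), t[]. Approaching
    from the left includes the final time [t = b]. *)
Lemma ae_itv_left (R : realType) (P : R -> Prop) (a b t : R) :
  {ae @lebesgue_measure R, forall s, s \in `]a, b[ -> P s} ->
  a < t <= b -> forall e : R, 0 < e ->
  exists s, [/\ s \in `]a, b[, `|s - t| < e & P s].
Proof.
move=> [N [mN N0 subN]] /andP[at_ tb] e e0.
pose c := Num.max a (t - e).
have ct : c < t by rewrite gt_max at_ ltrBlDr ltrDl.
have [s ss sN] : exists2 s, s \in `]c, t[ & ~ N s.
  apply: contrapT => /forall2NP h.
  have : (lebesgue_measure `]c, t[ <= @lebesgue_measure R N)%E.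
    apply: le_measure; rewrite ?inE// => s /= sct.
    by case: (h s) => [/(_ sct)//|/contrapT].
  by rewrite N0 lebesgue_measure_itv/= lte_fin ct -EFinD lee_fin leNgt subr_gt0 ct.
have : s \in `]c, t[ by [].
rewrite in_itv /= gt_max => /andP[/andP[as_ tes] st].
have sab : s \in `]a, b[ by rewrite in_itv /= as_ (lt_le_trans st tb).
exists s; split => //.
  by rewrite distrC gtr0_norm ?subr_gt0// ltrBlDr -ltrBlDl.
by apply: contrapT => Ps; apply: sN; apply: subN => /(_ sab).
Qed.

(** Each [u t] is an arbitrary representative of its class, so the bound is almost everywhere, and
    it holds at each single point where the representative is continuous. *)
Theorem theorem2p4 (R : realType) (d : nat) (alpha kappa T : R)
    (Omega : set 'rV[R]_d) (u0 : 'rV[R]_d -> R) (u : R -> 'rV[R]_d -> R)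
    (hd : d \in [:: 1%N; 2%N; 3%N])
    (halpha : 0 < alpha < 1) (hkappa : 0 < kappa) (hT : 0 < T)
    (hOmega : bounded_smooth_domain Omega)
    (hu0 : H2 Omega u0 /\ H10 Omega u0)
    (hu0_le1 : forall x, Omega x -> `|u0 x| <= 1)
    (hu : allen_cahn_solution Omega T alpha kappa u0 u) :
  forall t, 0 < t <= T ->
    {ae lebesgue_row d, forall x, Omega x -> `|u t x| <= 1} /\
    (forall x, Omega x -> {for x, continuous (u t)} -> `|u t x| <= 1).
Proof.
have [_ oO _ bO _] := hOmega.
have mO : measurable Omega := open_measurable_row oO.
have fO := bounded_set_lebesgue_row_lty mO bO.
have [[L2u [C uC]] [hH2 _] [w [[v hv hw] [lw _] pde]] hinit] := hu.
have a0 : 0 < alpha by case/andP: halpha.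
have good := almost_every_time_le1 halpha hT mO fO hu0_le1 hH2 hv hw lw pde hinit.
move=> t tT.
have t0T : t \in `[0, T] by rewrite in_itv /=; case/andP: tT => /ltW->.
suff ae1 : {ae lebesgue_row d, forall x, Omega x -> `|u t x| <= 1}.
  by split => // x; exact: ae_le1_continuous.
apply: (ae_le1_L2_closed mO fO (L2u t t0T)) => e e0.
have C1 : 0 < `|C| + 1 by rewrite ltr_wpDl.
have eC : 0 < e / (`|C| + 1) by rewrite divr_gt0.
(* The radius inverts the Hölder estimate: [|C| |s - t|^alpha <= |C| e/(|C| + 1) < e], with
   [|C| + 1] because the sign of [C] is unknown and [C] may be 0. *)
have [|s [sT st us]] := ae_itv_left good tT (e := (e / (`|C| + 1)) `^ alpha^-1).
  exact: powR_gt0.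
have s0T : s \in `[0, T] by apply: subset_itvW sT.
exists (u s); split => //; first exact: L2u.
apply: le_lt_trans (uC s t s0T t0T) _; rewrite lte_fin.
apply: (@le_lt_trans _ _ (`|C| * (e / (`|C| + 1)))).
  apply: (@le_trans _ _ (`|C| * `|s - t| `^ alpha)).
    by rewrite ler_wpM2r ?powR_ge0 ?ler_norm.
  rewrite ler_wpM2l//.
  have -> : e / (`|C| + 1) = (e / (`|C| + 1)) `^ alpha^-1 `^ alpha.
    by rewrite -powRrM mulVf ?lt0r_neq0// powRr1// ltW.
  by rewrite ge0_ler_powR ?nnegrE ?(ltW a0)// ?powR_ge0 ?ltW.
by rewrite mulrCA gtr_pMr// ltr_pdivrMr// mul1r ltrDl.
Qed.
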